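(* Let $r\ge1$. With respect to the metric $\mathrm d_{\mathcal L}$, the space $\mathcal L^{\le r}$ is the completion of $\mathcal L^r$; that is, $\mathcal L^{\le r}$ is complete and $\mathcal L^r$ is a dense subset of it.
   Context: $F$ is a global function field of prime characteristic with field of constants $\mathbb F_q$; $\infty$ is a fixed place of $F$ of degree $\delta$; $A\subset F$ is the ring of elements regular away from $\infty$; $|\cdot|$ is the absolute value at $\infty$ with $|\pi|=q^{-\delta}$ for a uniformiser $\pi$; $F_\infty$ is the completion of $F$, and $\mathbb C_\infty$ is the completion of an algebraic closure of $F_\infty$. A lattice is a finitely generated $A$-submodule $\Lambda\subset\mathbb C_\infty$ meeting every ball of finite radius in a finite set; its rank is its rank as a projective $A$-module. $\mathcal L^r$ is the set of lattices of rank $r$ and $\mathcal L^{\le r}$ the set of lattices of rank $\le r$ (including the zero lattice). The metric is $\mathrm d_{\mathcal L}(\Lambda_1,\Lambda_2)=\sup_{|z|\le1}|e_{\Lambda_1}(z)-e_{\Lambda_2}(z)|$, where $e_\Lambda(z)=z\prod_{0\ne\lambda\in\Lambda}(1-z/\lambda)$. *)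

(* Defs.v *)
From HB Require Import structures.
From mathcomp Require Import all_boot all_order all_algebra all_field.
From mathcomp Require Import all_classical all_reals all_analysis.

Set Implicit Arguments.
Unset Strict Implicit.
Unset Printing Implicit Defensive.

Import Order.TTheory GRing.Theory Num.Theory.

Local Open Scope classical_set_scope.
Local Open Scope ring_scope.

(* A place is encoded by its normalised discrete valuation.  The value
   [ord 0] is junk (it should be +oo), hence the guards [x != 0], [x = 0]
   in this definition and the following ones. *)
Record place (F : fieldType) := Place {
  ord :> F -> int;
  ordM : forall x y, x != 0 -> y != 0 -> ord (x * y) = ord x + ord y;
  ordD : forall x y, x != 0 -> y != 0 -> x + y != 0 ->
    Num.min (ord x) (ord y) <= ord (x + y);
  ord_surj : exists2 x, x != 0 & ord x = 1 }.

Definition same_place (F : fieldType) (P Q : place F) : Prop :=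
  forall x, x != 0 -> P x = Q x.

Definition valuation_ring (F : fieldType) (P : place F) : set F :=
  [set x | x = 0 \/ 0 <= P x].

Definition valuation_ideal (F : fieldType) (P : place F) : set F :=
  [set x | x = 0 \/ 0 < P x].

Definition regular_away (F : fieldType) (P : place F) : set F :=
  [set x | forall Q : place F, ~ same_place Q P -> valuation_ring Q x].

(* A function field over Fq is presented as a finite (not necessarily
   separable) extension of the rational function field Fq(t). *)
Definition const_emb (Fq : finFieldType)
    (F : fieldExtType {fraction {poly Fq}}) (c : Fq) : F :=
  (FracField.tofrac c%:P)%:A.

Definition full_constants (Fq : finFieldType)
    (F : fieldExtType {fraction {poly Fq}}) : Prop :=
  forall x : F, algebraicOver (@const_emb Fq F) x ->
    exists c : Fq, x = const_emb F c.

(* [d] is the dimension over Fq of the residue field at [P]: [b] is a family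
   of representatives of a basis. *)
Definition place_degree (Fq : finFieldType)
    (F : fieldExtType {fraction {poly Fq}}) (P : place F) (d : nat) : Prop :=
  exists b : 'I_d -> F, (forall k, valuation_ring P (b k)) /\
    forall x, valuation_ring P x -> exists! c : {ffun 'I_d -> Fq},
      valuation_ideal P (x - \sum_k const_emb F (c k) * b k).

Definition place_abs (R : realType) (F : fieldType) (P : place F)
    (q d : nat) (x : F) : R :=
  if x == 0 then 0 else (q%:R : R) ^ (- (d%:Z * P x)).

(* Non-archimedean absolute values.  [normedZmodType] cannot be used here: it
   imposes |x *+ n| = |x| *+ n, which fails in positive characteristic. *)
Record absval (R : realType) (K : fieldType) := Absval {
  abs :> K -> R;
  abs_ge0 : forall x, 0 <= abs x;
  abs_eq0 : forall x, (abs x == 0) = (x == 0);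
  absM : forall x y, abs (x * y) = abs x * abs y;
  absD : forall x y, abs (x + y) <= Num.max (abs x) (abs y) }.

Section AbsvalTheory.
Variables (R : realType) (K : fieldType) (v : absval R K).

Lemma abs0 : v 0 = 0.
Proof. by apply/eqP; rewrite abs_eq0. Qed.

Lemma abs1 : v 1 = 1.
Proof.
have v10 : v 1 != 0 by rewrite abs_eq0 oner_eq0.
by apply: (mulfI v10); rewrite -absM !mulr1.
Qed.

Lemma absN x : v (- x) = v x.
Proof.
have : v (-1) ^+ 2 == 1 by rewrite expr2 -absM mulrNN mulr1 abs1.
rewrite sqrf_eq1 => /orP[|] /eqP vN1; first by rewrite -mulN1r absM vN1 mul1r.
by have := abs_ge0 v (-1); rewrite vN1 oppr_ge0 ler10.
Qed.

Lemma abs_distC x y : v (x - y) = v (y - x).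
Proof. by rewrite -absN opprB. Qed.

Lemma abs_triangle y x z : v (x - z) <= v (x - y) + v (y - z).
Proof.
rewrite -(subrKA y) (le_trans (absD _ _ _))// ge_max.
by rewrite lerDl lerDr !abs_ge0.
Qed.

End AbsvalTheory.

(* The field [K] with the topology of the absolute value [v]. *)
Definition vtop (R : realType) (K : fieldType) (v : absval R K) : Type := K.

Section Vtop.
Variables (R : realType) (K : fieldType) (v : absval R K).

HB.instance Definition _ := Choice.on (vtop v).
HB.instance Definition _ := isPointed.Build (vtop v) (0 : K).

Let dist (x y : vtop v) : R := v ((x : K) - (y : K)).

Let distxx x : dist x x = 0.
Proof. by rewrite /dist subrr abs0. Qed.

Let dist_pos x y : dist x y = 0 -> x = y.
Proof. by move=> /eqP; rewrite /dist abs_eq0 subr_eq0 => /eqP. Qed.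

Let dist_sym x y : dist x y = dist y x.
Proof. exact: abs_distC. Qed.

Let dist_triangle y x z : dist x z <= dist x y + dist y z.
Proof. exact: abs_triangle. Qed.

HB.instance Definition _ :=
  @isMetric.Build R (vtop v) dist distxx dist_pos dist_sym dist_triangle.

End Vtop.

(* The axiom of [completeType], as a predicate. *)
Definition cauchy_complete (T : puniformType) : Prop :=
  forall F : set_system T, ProperFilter F -> cauchy F -> cvg F.

Definition is_completion (R : realType) (K L : fieldType) (w : K -> R)
    (v : absval R L) (j : {rmorphism K -> L}) : Prop :=
  [/\ forall x, v (j x) = w x,
      cauchy_complete (vtop v)
    & dense (range j : set (vtop v))].

Definition is_algebraic_closure (K : fieldType) (L : closedFieldType)
    (j : {rmorphism K -> L}) : Prop :=
  forall x : L, algebraicOver j x.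

Section Lattices.
Variables (R : realType) (F C : fieldType) (P : place F).
Variables (v : absval R C) (i : {rmorphism F -> C}).

Let A : set F := regular_away P.

Definition A_span (n : nat) (g : 'I_n -> C) : set C :=
  [set z | exists2 a : 'I_n -> F, (forall k, A (a k)) &
    z = \sum_k i (a k) * g k].

Definition is_lattice (L : set C) : Prop :=
  (exists n (g : 'I_n -> C), L = A_span g) /\
  forall rho : R, finite_set (L `&` [set z | v z <= rho]).

Definition A_free (n : nat) (b : 'I_n -> C) : Prop :=
  forall a : 'I_n -> F, (forall k, A (a k)) ->
    \sum_k i (a k) * b k = 0 -> forall k, a k = 0.

(* The rank of a projective module over the domain A, i.e. its dimension after
   tensoring with Frac A, as the maximal length of an A-free family. *)
Definition has_rank (L : set C) (n : nat) : Prop :=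
  (exists2 b : 'I_n -> C, (forall k, L (b k)) & A_free b) /\
  (forall b : 'I_n.+1 -> C, (forall k, L (b k)) -> ~ A_free b).

(* The product over the nonzero elements of [L], as the limit of the finite
   products over those of absolute value at most [N]. *)
Definition lattice_exp (L : set C) (z : C) : vtop v :=
  lim ((fun N : nat => z * \big[*%R/1]_(l \in L `&`
          [set l | l != 0 /\ v l <= N%:R]) (1 - z / l) : vtop v) @ \oo).

Definition lattice_dist (L1 L2 : set C) : \bar R :=
  ereal_sup [set (v ((lattice_exp L1 z : C) - lattice_exp L2 z))%:E |
    z in [set z | v z <= 1]].

Record lattice_le (r : nat) := LatticeLe {
  carrier :> set C;
  carrier_lattice : is_lattice carrier;
  carrier_rank : exists2 s, (s <= r)%N & has_rank carrier s }.

Definition lattice_eq (r : nat) : set (lattice_le r) :=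
  [set L | has_rank L r].

Lemma ord_1 (Q : place F) : Q 1 = 0.
Proof.
have := ordM Q (oner_neq0 F) (oner_neq0 F); rewrite mulr1 => /esym/eqP.
by rewrite -subr_eq0 addrK => /eqP.
Qed.

Lemma zero_is_lattice : is_lattice [set 0].
Proof.
split; last by move=> rho; apply/finite_setIl/finite_set1.
exists 0%N, (fun=> 0); apply/seteqP; split => z /=.
  by move=> ->; exists (fun=> 0); rewrite ?big_ord0//; case.
by move=> [a _ ->]; rewrite big_ord0.
Qed.

Lemma zero_rank r : exists2 s, (s <= r)%N & has_rank [set 0] s.
Proof.
exists 0%N => //; split; first by exists (fun=> 0) => [[]|? _ _ []].
move=> b b0 bfree; have /eqP : (1 : F) = 0; last by rewrite oner_eq0.
apply: (bfree (fun=> 1) _ _ ord0); last by rewrite big_ord1 (b0 ord0) mulr0.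
by move=> _ Q _; right; rewrite ord_1.
Qed.

Definition zero_lattice r : lattice_le r :=
  LatticeLe zero_is_lattice (zero_rank r).

Local Open Scope ereal_scope.

Lemma lattice_distxx L : lattice_dist L L = 0.
Proof.
apply/eqP; rewrite eq_le; apply/andP; split.
  by apply: ge_ereal_sup => _ [z _ <-]; rewrite subrr abs0.
apply: ereal_sup_ubound; exists 0%R; last by rewrite subrr abs0.
by rewrite /= abs0 ler01.
Qed.

Lemma lattice_dist_sym L1 L2 : lattice_dist L1 L2 = lattice_dist L2 L1.
Proof.
by congr ereal_sup; apply: eq_imagel => z _; rewrite abs_distC.
Qed.

Lemma lattice_dist_triangle L2 L1 L3 :
  lattice_dist L1 L3 <= lattice_dist L1 L2 + lattice_dist L2 L3.
Proof.
apply: ge_ereal_sup => _ [z z1 <-].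
have le_dist L L' :
    (v ((lattice_exp L z : C) - lattice_exp L' z))%:E <= lattice_dist L L'.
  by apply: ereal_sup_ubound; exists z.
apply: le_trans (leeD (le_dist L1 L2) (le_dist L2 L3)).
by rewrite -EFinD lee_fin abs_triangle.
Qed.

End Lattices.

Section LatticeTopology.
Variables (R : realType) (F C : fieldType) (P : place F).
Variables (v : absval R C) (i : {rmorphism F -> C}) (r : nat).

Local Notation T := (lattice_le P v i r).

HB.instance Definition _ := gen_eqMixin T.
HB.instance Definition _ := gen_choiceMixin T.
HB.instance Definition _ := isPointed.Build T (zero_lattice P v i r).

Definition lattice_ball (L1 : T) (e : R) : set T :=
  [set L2 : T | (lattice_dist v L1 L2 < e%:E)%E].

Let ball_center L (e : R) : 0 < e -> lattice_ball L e L.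
Proof. by move=> e0; rewrite /lattice_ball/= lattice_distxx lte_fin. Qed.

Let ball_sym L1 L2 (e : R) : lattice_ball L1 e L2 -> lattice_ball L2 e L1.
Proof. by rewrite /lattice_ball/= lattice_dist_sym. Qed.

Let ball_triangle L1 L2 L3 e1 e2 : lattice_ball L1 e1 L2 ->
  lattice_ball L2 e2 L3 -> lattice_ball L1 (e1 + e2) L3.
Proof.
move=> h1 h2; rewrite /lattice_ball/= EFinD.
exact: le_lt_trans (lattice_dist_triangle v L2 L1 L3) (lteD h1 h2).
Qed.

Let ent : set_system (T * T) := entourage_ lattice_ball.

HB.instance Definition _ := hasNbhs.Build T (nbhs_ ent).
HB.instance Definition _ := @Nbhs_isPseudoMetric.Build R T ent erefl
  lattice_ball ball_center ball_sym ball_triangle erefl.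

End LatticeTopology.

(* Main.v *)
Require Import Defs.
From HB Require Import structures.
From mathcomp Require Import all_boot all_order all_algebra all_field.
From mathcomp Require Import all_classical all_reals all_analysis.
From mathcomp Require Import finmap zify ring lra.

Set Implicit Arguments.
Unset Strict Implicit.
Unset Printing Implicit Defensive.

Import Order.TTheory GRing.Theory Num.Theory.

Local Open Scope classical_set_scope.
Local Open Scope ring_scope.

(** Let [A] be the ring of functions regular away from [infty] and write [|x|] for
    the absolute value.

    The arithmetic input is that [A] is discrete: a nonzero element of [A] has
    absolute value at least 1, and balls contain finitely many elements of [A].
    For the former, an element vanishing at [infty] must have a pole, which is
    another place ([exists_pole]): if [x] has a zero, a maximal subring of [F]
    containing [x^-1] but not [x] is a discrete valuation ring.  The latter follows
    as the residue field at [infty] is finite ([regular_bounded_poles]).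

    Density.  Given a lattice [L], an [F]-subspace of finite dimension containing
    it misses, modulo the value group of [F], the absolute value of some power of a
    root of a uniformiser ([transverse_direction]).  Each multiple [w]
    of this power by a nonzero element of [F] satisfies [|a w + l| >= |a w|] for all
    [a] in [A] and [l] in [L], so [L + A w] is a lattice of rank one more.  Taking [w] large, its new elements are large and the
    exponential changes little on the unit ball ([exp_superlattice_close]).

    Completeness.  Consider a Cauchy filter of lattices of rank at most [r].
    - Their exponentials are eventually bounded on the unit ball by some [B], so
      nonzero lattice elements have absolute value at least [1 / B]
      ([min_abs_of_exp_bound]).  The number of elements in a ball of radius [rho]
      is then at most some [K rho] depending on [r] and [B] only ([count_bound]):
      for [T] in [A] with [|T| > 1], the index of [T L] in [L] is at most
      [#|A / T A| ^ r], and two elements of a ball congruent modulo a high power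
      of [T] are equal.  If there is no such [T], then [A] is a finite field and
      [L] a vector space of dimension at most [r].
    - These bounds make the coefficients of the exponentials decay uniformly.  As
      the residue field is infinite, the supremum over the unit ball bounds every
      coefficient of the difference of two exponentials; hence closeness on
      the unit ball implies closeness on every ball
      ([exp_close_propagates]).
    - The distance from [z] to a lattice is at most the absolute value of its
      exponential at [z] ([exp_ge_dist]).  Thus on every ball the lattices are
      eventually close to each other pointwise, and they converge to a discrete
      [A]-module, as the field is complete.  The bound [K] passes to the limit
      and forces its rank to be at most [r]; being discrete of finite rank it is
      finitely generated ([discrete_finitely_generated]).
    - The partial products of the exponentials converge to those of the limit, at
      a uniform rate, so the limit lattice is a limit for the metric
      ([cauchy_lattices_converge]). *)

(** * Algebraic relations of bounded degree in a function field *)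

Lemma fraction_clear (R : idomainType) (x : {fraction R}) :
  exists d n : R, d != 0 /\ FracField.tofrac d * x = FracField.tofrac n.
Proof.
elim/quotW: x => x; exists (frac x).2, (frac x).1; split; first exact: denom_ratioP.
rewrite -[LHS]/(FracField.mul _ _).
unlock FracField.tofrac; rewrite !piE.
apply/eqmodP => /=; rewrite FracField.equivfE /FracField.mulf.
by rewrite !numden_Ratio ?(oner_neq0, mul1r, mulr1, mulf_neq0, denom_ratioP)// mulrC.
Qed.

Section FunctionField.
Variables (Fq : finFieldType) (F : fieldExtType {fraction {poly Fq}}).

Local Notation "p %:F" := (@FracField.tofrac {poly Fq} p) (at level 1, format "p %:F").

Definition const_rmorph : {rmorphism Fq -> F} :=
  (GRing.in_alg F \o @FracField.tofrac {poly Fq} \o polyC)%FUN.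

Section Counting.
Variables (m : nat) (e : 'I_m -> F).
Hypothesis span_e :
  forall x : F, exists c : 'I_m -> {fraction {poly Fq}}, x = \sum_j c j *: e j.

Definition degree_lt (k : nat) : set F := [set x | exists2 p : 'I_m -> {poly Fq},
  forall j, (size (p j) <= k)%N & x = \sum_j (p j)%:F *: e j].

Lemma degree_ltW k k' x : (k <= k')%N -> degree_lt k x -> degree_lt k' x.
Proof. by move=> kk' [p pk ->]; exists p => // j; exact: leq_trans kk'. Qed.

Lemma degree_lt_sum (I : finType) k (x : I -> F) :
  (forall j, degree_lt k (x j)) -> degree_lt k (\sum_j x j).
Proof.
move=> /(_ _)/cid2-/all_sig2[p pk xE].
exists (fun i => \sum_j p j i) => [i|].
  by apply: (leq_trans (size_sum _ _ _)); apply/bigmax_leqP => j _; exact: pk.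
rewrite (eq_bigr _ (fun j _ => xE j)) exchange_big/=; apply: eq_bigr => i _.
by rewrite rmorph_sum/= scaler_suml.
Qed.

Lemma degree_ltZ k x (p : {poly Fq}) :
  degree_lt k x -> degree_lt (k + size p) (p%:F *: x).
Proof.
move=> [q qk ->]; exists (fun j => p * q j) => [j|].
  apply: (leq_trans (size_polyMleq _ _)).
  by apply: (leq_trans (leq_pred _)); rewrite addnC leq_add2r.
by rewrite scaler_sumr; apply: eq_bigr => j _; rewrite rmorphM/= scalerA.
Qed.

Lemma common_denominator (s : seq F) : exists D : {poly Fq}, exists k,
  D != 0 /\ forall x, x \in s -> degree_lt k (D%:F *: x).
Proof.
elim: s => [|x s [D [k [D0 Ds]]]]; first by exists 1, 0; rewrite oner_neq0.
suff [E [l [E0 El]]] : exists E : {poly Fq}, exists l,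
    E != 0 /\ degree_lt l (E%:F *: x).
  exists (D * E), (k + size E + (l + size D))%N; split; first by rewrite mulf_neq0.
  move=> z; rewrite inE => /predU1P[->|/Ds zs].
    by rewrite rmorphM -scalerA; apply: degree_ltW _ (degree_ltZ D El); rewrite leq_addl.
  rewrite mulrC rmorphM -scalerA.
  by apply: degree_ltW _ (degree_ltZ E zs); rewrite leq_addr.
have [c ->] := span_e x.
have /(_ _)/cid-/all_sig[d] : forall j, exists d n : {poly Fq},
  d != 0 /\ d%:F * c j = n%:F by move=> j; exact: fraction_clear.
move=> /(_ _)/cid-/all_sig[n dn].
exists (\prod_j d j), (\max_j size (n j * \prod_(l | l != j) d l)%R); split.
  by rewrite prodf_seq_neq0; apply/allP => j _ /=; have [] := dn j.
exists (fun j => n j * \prod_(l | l != j) d l) => [j|]; first exact: leq_bigmax.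
rewrite scaler_sumr; apply: eq_bigr => j _; rewrite scalerA (bigD1 j)//=.
by congr (_ *: _); rewrite !rmorphM/= mulrAC; have [_ ->] := dn j.
Qed.

(** The matrix of multiplication by [y] in the basis [e] has entries of bounded
    degree over a common denominator [D]. *)
Lemma degree_lt_exp (y : F) : exists D : {poly Fq}, exists d, D != 0 /\
  forall M a k x, (a <= M)%N -> degree_lt k x ->
    degree_lt (k + M * d) ((D ^+ M)%:F *: (y ^+ a * x)).
Proof.
have [D [d [D0 yE]]] := common_denominator [seq y * e j | j : 'I_m].
exists D, (d + size D)%N; split => // M; elim: M => [|M IH] a k x.
  by rewrite leqn0 => /eqP-> xk; rewrite !expr0 rmorph1 scale1r mul1r mul0n addn0.
case: a => [_|a aM] xk.
  rewrite exprS rmorphM -scalerA.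
  apply: degree_ltW _ (degree_ltZ D (IH 0 _ _ (leq0n _) xk)).
  by rewrite -addnA leq_add2l mulSnr leq_add2l leq_addl.
have [p pk xE] := IH a _ _ aM xk.
rewrite exprS rmorphM -scalerA exprS -mulrA scalerAr xE mulr_sumr scaler_sumr.
apply: degree_lt_sum => j; rewrite -scalerAr scalerA mulrC -scalerA.
have /yE/degree_ltZ-/(_ (p j)) : y * e j \in [seq y * e j | j : 'I_m].
  by apply/mapP; exists j; rewrite ?mem_enum.
apply: degree_ltW; rewrite (leq_trans (leq_add (leqnn _) (pk j)))//.
by rewrite mulSn [leqRHS]addnCA leq_add// leq_addr.
Qed.

Lemma degree_lt_codeP k : exists g : {ffun 'I_m * 'I_k -> Fq} -> F,
  degree_lt k `<=` range g.
Proof.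
exists (fun c => \sum_j (\poly_(i < k) (if insub i is Some i' then c (j, i') else 0))%:F *: e j).
move=> x [p pk ->]; exists [ffun ji : 'I_m * 'I_k => (p ji.1)`_(ji.2)] => //.
apply: eq_bigr => j _; congr (_%:F *: _); apply/polyP => i; rewrite coef_poly.
case: ltnP => ik; last by rewrite nth_default// (leq_trans (pk j)).
by rewrite insubT ffunE.
Qed.

(** The products [y ^+ a * z ^+ b] with [a < M] and [b < n] lie, up to a common
    denominator, in a space of dimension [m * (M * d + O(1))] over [Fq]: for
    [n > m * d] and [M] large there are too many of them to be independent.
    The bound on [n] depends on [y] only. *)
Lemma algebraic_relation_bound (y : F) : exists n, forall z : F,
  exists2 f : 'I_n -> {poly Fq}, (exists b, f b != 0) &
    \sum_b (map_poly const_rmorph (f b)).[y] * z ^+ b = 0.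
Proof.
have [D [d [D0 Dy]]] := degree_lt_exp y.
(* Counting [Fq]-dimensions, [n * M] products live in dimension [m * (k + M * d)]. *)
exists (m * d).+1 => z; set n := (m * d).+1.
have [E [k [E0 Ez]]] := common_denominator [seq z ^+ b | b : 'I_n].
pose M := (m * k).+1; pose l := (k + M * d)%N.
pose f (c : {ffun 'I_n * 'I_M -> Fq}) (b : 'I_n) : {poly Fq} :=
  \poly_(i < M) (if insub i is Some i' then c (b, i') else 0).
pose S c := \sum_b (map_poly const_rmorph (f c b)).[y] * z ^+ b.
have fE c b : (map_poly const_rmorph (f c b)).[y] = \sum_(i < M) const_rmorph (c (b, i)) * y ^+ i.
  rewrite (@horner_coef_wide _ M); last first.
    by rewrite (leq_trans (size_poly _ _))// size_poly.
  apply: eq_bigr => i _; rewrite coef_map coef_poly ltn_ord/=.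
  by rewrite valK.
have Sk c : degree_lt l ((D ^+ M * E)%:F *: S c).
  rewrite /S scaler_sumr; apply: degree_lt_sum => b.
  rewrite fE mulr_suml scaler_sumr; apply: degree_lt_sum => i.
  rewrite -mulrA mulr_algl -[_ *: _]/(_ *: _) scalerA mulrC -scalerA.
  have [p pl] : degree_lt l ((D ^+ M * E)%:F *: (y ^+ i * z ^+ b)).
    rewrite rmorphM -scalerA scalerAr; apply: Dy; first exact: ltnW.
    by apply: Ez; apply/mapP; exists b; rewrite ?mem_enum.
  move=> ->; exists (fun j => (c (b, i))%:P * p j) => [j|].
    by rewrite mul_polyC (leq_trans (size_scale_leq _ _)).
  by rewrite scaler_sumr; apply: eq_bigr => j _; rewrite rmorphM/= scalerA.
have [g gP] := degree_lt_codeP l.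
have /(_ _)/cid-/all_sig[h hP] : forall c, exists h, g h = (D ^+ M * E)%:F *: S c.
  by move=> c; have [h _ hP] := gP _ (Sk c); exists h.
have : ~~ injectiveb h.
  apply/negP => /injectiveP /leq_card.
  rewrite !card_ffun !card_prod !card_ord leq_exp2l ?finNzRing_gt1// /l /n.
  suff lt_nM : (m * (k + M * d) < n * M)%N by rewrite leqNgt lt_nM.
  by rewrite /n mulSn mulnDr (mulnCA m M d) [(M * _)%N]mulnC ltn_add2r.
move=> /injectivePn[c1 [c2 c12 h12]].
have S12 : S c1 = S c2.
  have : (D ^+ M * E)%:F != 0 by rewrite tofrac_eq0 mulf_neq0// expf_neq0.
  by move=> /scalerI; apply; rewrite -!hP h12.
exists (fun b => f c1 b - f c2 b); last first.
  transitivity (S c1 - S c2); last by rewrite S12 subrr.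
  by rewrite /S -sumrB; apply: eq_bigr => b _; rewrite rmorphB hornerD hornerN mulrBl.
apply: contrapT => /forallNP f0; move/eqP: c12; apply.
apply/ffunP => -[b i]; have /negP := f0 b; rewrite negbK subr_eq0 => /eqP.
by move=> /polyP/(_ i); rewrite !coef_poly ltn_ord valK.
Qed.

End Counting.

Lemma relation_bound (y : F) : exists n, forall z : F,
  exists2 f : 'I_n -> {poly Fq}, (exists b, f b != 0) &
    \sum_b (map_poly const_rmorph (f b)).[y] * z ^+ b = 0.
Proof.
apply: (@algebraic_relation_bound _ (fun j => (vbasis {:F})`_j)) => x.
exists (fun j => coord (vbasis {:F}) j x).
by rewrite {1}(coord_vbasis (memvf x)).
Qed.

End FunctionField.

(** * Places of a function field, and poles *)

Section PlaceTheory.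
Variables (F : fieldType) (P : place F).

Lemma ordV x : x != 0 -> P x^-1 = - P x.
Proof.
move=> x0; have xV0 : x^-1 != 0 by rewrite invr_eq0.
have := ordM P x0 xV0; rewrite mulfV// ord_1 addrC => /esym/eqP.
by rewrite addr_eq0 => /eqP.
Qed.

Lemma ordX x n : x != 0 -> P (x ^+ n) = P x *+ n.
Proof.
move=> x0; elim: n => [|n IH]; first by rewrite expr0 ord_1 mulr0n.
by rewrite exprS mulrS ordM ?expf_neq0// IH.
Qed.

Lemma ordN x : P (- x) = P x.
Proof.
have [->|x0] := eqVneq x 0; first by rewrite oppr0.
have N1 : (-1 : F) != 0 by rewrite oppr_eq0 oner_neq0.
have : P (-1) *+ 2 = 0 by rewrite -ordX// sqrrN expr1n ord_1.
move=> /eqP; rewrite mulrn_eq0/= => /eqP PN1.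
by rewrite -(mulN1r x) ordM// PN1 add0r.
Qed.

Lemma ordD_ge x y (n : int) : x + y != 0 ->
  (x != 0 -> n <= P x) -> (y != 0 -> n <= P y) -> n <= P (x + y).
Proof.
have [->|x0] := eqVneq x 0; first by rewrite add0r => y0 _; exact.
have [->|y0] := eqVneq y 0; first by rewrite addr0 => _ xn _; exact: xn.
move=> xy0 /(_ isT) xn /(_ isT) yn.
by apply: le_trans (ordD P x0 y0 xy0); rewrite le_min xn.
Qed.

End PlaceTheory.

Lemma ord_const (Fq : finFieldType) (F : fieldExtType {fraction {poly Fq}})
  (P : place F) (c : Fq) : c != 0 -> P (const_rmorph F c) = 0.
Proof.
move=> c0; have q1 : (0 < #|Fq|.-1)%N by rewrite -subn1 subn_gt0 finNzRing_gt1.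
have cX : c ^+ #|Fq|.-1 = 1.
  by apply: (mulfI c0); rewrite -exprS prednK ?expf_card ?mulr1//; exact/ltnW/finNzRing_gt1.
have : P (const_rmorph F c) *+ #|Fq|.-1 = 0.
  by rewrite -ordX ?fmorph_eq0// -rmorphXn cX rmorph1; exact: ord_1.
by move=> /eqP; rewrite mulrn_eq0 -leqn0 leqNgt q1 => /eqP.
Qed.

(** The value group of [w] is a nonzero subgroup of the integers, hence infinite
    cyclic; dividing by its positive generator gives a normalised valuation. *)
Lemma place_of_valuation (F : fieldType) (w : F -> int) :
  (forall x y, x != 0 -> y != 0 -> w (x * y) = w x + w y) ->
  (forall x y, x != 0 -> y != 0 -> x + y != 0 ->
    Num.min (w x) (w y) <= w (x + y)) ->
  (exists2 y, y != 0 & 0 < w y) ->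
  exists (Q : place F) (d : int), 0 < d /\ forall x, x != 0 -> w x = Q x * d.
Proof.
move=> wM wD [y y0 wy].
have w1 : w 1 = 0.
  have := wM _ _ (oner_neq0 F) (oner_neq0 F); rewrite mulr1 => /esym/eqP.
  by rewrite -subr_eq0 addrK => /eqP.
have wV x : x != 0 -> w x^-1 = - w x.
  move=> x0; have := wM _ x^-1 x0; rewrite invr_eq0 mulfV// w1 => /(_ x0)/esym.
  by rewrite addrC => /eqP; rewrite addr_eq0 => /eqP.
have wX x n : x != 0 -> w (x ^+ n) = w x * n%:Z.
  move=> x0; elim: n => [|n IH]; first by rewrite w1 mulr0.
  by rewrite exprS wM ?expf_neq0// IH intS mulrDr mulr1.
have wXz x (n : int) : x != 0 -> w (x ^ n) = w x * n.
  move=> x0; case: n => n; first exact: wX.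
  by rewrite NegzE -exprnN wV ?expf_neq0// wX// mulrN.
pose p (d : nat) := `[< (0 < d)%N /\ exists2 z, z != 0 & w z = d%:Z >].
have /ex_minnP[d /asboolP[d0 [z z0 wz]] dmin] : exists d, p d.
  by exists `|w y|%N; apply/asboolP; split; [|exists y => //]; lia.
have dw x : x != 0 -> w x = (w x %/ d)%Z * d.
  move=> x0; rewrite [LHS](divz_eq _ d); suff -> : (w x %% d)%Z = 0 by rewrite addr0.
  apply/eqP/negP => /negP r0.
  have : p `|(w x %% d)%Z|%N.
    apply/asboolP; split; first by rewrite absz_gt0.
    exists (x * (z ^ (- (w x %/ d)%Z))); first by rewrite mulf_neq0 ?expfz_neq0.
    rewrite wM ?expfz_neq0// wXz// wz gez0_abs ?modz_ge0//; last by lia.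
    by rewrite {1}(divz_eq (w x) d); ring.
  by move=> /dmin; have := @ltz_pmod (w x) d; lia.
pose Q x := (w x %/ d)%Z.
have QM x x' : x != 0 -> x' != 0 -> Q (x * x') = Q x + Q x'.
  move=> x0 x'0; have d0' : d%:Z != 0 by lia.
  by apply: (mulIf d0'); rewrite mulrDl -!dw ?mulf_neq0// wM.
have QD x x' : x != 0 -> x' != 0 -> x + x' != 0 ->
    Num.min (Q x) (Q x') <= Q (x + x').
  move=> x0 x'0 xx'; have := wD _ _ x0 x'0 xx'; rewrite (dw _ x0) (dw _ x'0) (dw _ xx').
  by rewrite -minr_pMl ?ler_pM2r//; lia.
have Qz : exists2 x, x != 0 & Q x = 1.
  by exists z => //; rewrite /Q wz divzz; case: eqP => //; lia.
exists (Place QM QD Qz), d; split; first by lia.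
by move=> x; exact: dw.
Qed.
Section PoleExistence.
Variables (Fq : finFieldType) (F : fieldExtType {fraction {poly Fq}}).
Variables (P : place F) (x : F).
Hypotheses (x0 : x != 0) (Px : 0 < P x).

Let y := x^-1.
Let y0 : y != 0. Proof. by rewrite invr_eq0. Qed.
Let Py : P y < 0. Proof. by rewrite ordV// oppr_lt0. Qed.
Local Notation const := (const_rmorph F).

(** Subrings of [F] in which [y] is not invertible. *)
Definition pole_ring (S : set F) : Prop :=
  [/\ forall c, S (const c), forall a b, S a -> S b -> S (a - b),
      forall a b, S a -> S b -> S (a * b), S y & ~ S x].

Let polys_in_y : set F := [set (map_poly const f).[y] | f in setT].

Let polys_in_y_pole (f : {poly Fq}) :
  (map_poly const f).[y] != 0 -> P (map_poly const f).[y] <= 0.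
Proof.
elim/poly_ind: f => [|f c IH]; first by rewrite rmorph0 horner0 eqxx.
have -> : map_poly const (f * 'X + c%:P) = map_poly const f * 'X + (const c)%:P.
  by rewrite rmorphD rmorphM/= map_polyX map_polyC.
rewrite hornerMXaddC; set u := (map_poly _ f).[y] in IH *.
have [->|u0] := eqVneq u 0.
  by rewrite mul0r add0r fmorph_eq0 => c0; rewrite ord_const.
move=> uc0; rewrite leNgt; apply/negP => Puc.
have : 0 <= P (u * y).
  rewrite -(addrK (const c) (u * y)); apply: ordD_ge.
  - by rewrite addrK mulf_neq0.
  - by move=> _; exact: ltW.
  - by rewrite ordN oppr_eq0 fmorph_eq0 => c0; rewrite ord_const.
by rewrite leNgt ordM// (le_lt_trans _ Py)// gerDr IH.
Qed.

Let polys_in_y_pole_ring : pole_ring polys_in_y.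
Proof.
split.
- by move=> c; exists c%:P => //; rewrite map_polyC hornerC.
- by move=> _ _ [f _ <-] [g _ <-]; exists (f - g) => //; rewrite rmorphB !hornerE.
- by move=> _ _ [f _ <-] [g _ <-]; exists (f * g) => //; rewrite rmorphM !hornerE.
- by exists 'X => //; rewrite map_polyX hornerX.
- by move=> [f _ fx]; have := @polys_in_y_pole f; rewrite fx leNgt Px => /(_ x0).
Qed.

Lemma maximal_pole_ring : exists2 S, pole_ring S &
  forall B, S `<=` B -> pole_ring B -> B `<=` S.
Proof.
pose good (S : set F) := S = set0 \/ pole_ring S.
have [|S [gS maxS]] := @Zorn_bigcup F good.
  move=> Ch gCh totCh.
  have [[X [ChX [c Xc]]]|allN] := pselect (exists X, Ch X /\ exists c, X c); last first.
    by left; apply/seteqP; split => // c [X ChX Xc]; apply: allN; exists X; split => //; exists c.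
  right; have ringX Y d : Ch Y -> Y d -> pole_ring Y.
    by move=> /gCh[->//|].
  have [cX _ _ yX _] := ringX _ _ ChX Xc.
  have join (op : F -> F -> F) : (forall Y, pole_ring Y -> forall a b, Y a -> Y b -> Y (op a b)) ->
      forall a b, (\bigcup_(Y in Ch) Y) a -> (\bigcup_(Y in Ch) Y) b -> (\bigcup_(Y in Ch) Y) (op a b).
    move=> opP a b [Y ChY Ya] [Z ChZ Zb]; have [YZ|ZY] := totCh _ _ ChY ChZ.
      by exists Z => //; apply: opP => //; [exact: ringX Zb|exact: YZ].
    by exists Y => //; apply: opP => //; [exact: ringX Ya|exact: ZY].
  split; [by move=> d; exists X| | |by exists X|].
  - by apply: (join (fun a b => a - b)) => Y [].
  - by apply: (join (fun a b => a * b)) => Y [].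
  - by move=> [Y ChY Yx]; have [] := ringX _ _ ChY Yx.
have rS : pole_ring S.
  case: gS => // S0; exfalso; apply: (maxS polys_in_y); last by right.
  by rewrite S0; split => //; case: polys_in_y_pole_ring => _ _ _ yp _ /(_ y yp).
exists S => // B SB rB; apply: contrapT => BS.
by apply: (maxS B); [split|right].
Qed.

Section ValuationRing.
Variable S : set F.
Hypotheses (rS : pole_ring S)
  (maxS : forall B, S `<=` B -> pole_ring B -> B `<=` S).

Let Sc c : S (const c). Proof. by case: rS. Qed.
Let SB a b : S a -> S b -> S (a - b). Proof. by case: rS => _ + _ _ _; apply. Qed.
Let SM a b : S a -> S b -> S (a * b). Proof. by case: rS => _ _ + _ _; apply. Qed.
Let Sy : S y. Proof. by case: rS. Qed.
Let Sx : ~ S x. Proof. by case: rS. Qed.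
Let S0 : S 0. Proof. by rewrite -(rmorph0 const). Qed.
Let S1 : S 1. Proof. by rewrite -(rmorph1 const). Qed.
Let SN a : S a -> S (- a). Proof. by move=> Sa; rewrite -sub0r; exact: SB. Qed.
Let SD a b : S a -> S b -> S (a + b).
Proof. by move=> Sa Sb; rewrite -[b]opprK; apply/SB/SN. Qed.
Let SX a n : S a -> S (a ^+ n).
Proof. by move=> Sa; elim: n => [|n IH]; rewrite ?expr0// exprS; exact: SM. Qed.
Let Ssum (I : finType) (p : pred I) (f : I -> F) :
  (forall i, p i -> S (f i)) -> S (\sum_(i | p i) f i).
Proof. by move=> Sf; elim/big_rec: _ => // i a pi Sa; apply: SD => //; exact: Sf. Qed.

(** Inverting [1 - y * u] does not create an inverse of [y], so by maximality the
    inverse is already there: [S] is local and [y] is in its maximal ideal. *)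
Let unit_1B u : S u -> S (1 - y * u)^-1.
Proof.
move=> Su; set e := 1 - y * u.
have e0 : e != 0.
  rewrite subr_eq0; apply/eqP => yu1; apply: Sx.
  by rewrite -[x]mulr1 yu1 mulrA mulfV// mul1r.
have Se : S e by apply: SB => //; exact: SM.
pose B := [set z | exists2 a, S a & exists k, z = a / e ^+ k].
apply: (maxS (B := B)); last by exists 1 => //; exists 1; rewrite div1r expr1.
  by move=> a Sa; exists a => //; exists 0; rewrite expr0 divr1.
split.
- by move=> c; exists (const c) => //; exists 0; rewrite expr0 divr1.
- move=> _ _ [a Sa [k ->]] [b Sb [l ->]].
  exists (a * e ^+ l - b * e ^+ k); first by apply: SB; apply: SM => //; exact: SX.
  exists (k + l)%N; rewrite exprD mulrBl; congr (_ - _).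
    by rewrite -mulf_div divff ?mulr1// expf_neq0.
  by rewrite [e ^+ k * _]mulrC -mulf_div divff ?mulr1// expf_neq0.
- move=> _ _ [a Sa [k ->]] [b Sb [l ->]]; exists (a * b); first exact: SM.
  by exists (k + l)%N; rewrite mulf_div exprD.
- by exists y => //; exists 0; rewrite expr0 divr1.
- move=> [a Sa [k xE]].
  have [u' Su' ek] : exists2 u', S u' & e ^+ k = 1 - y * u'.
    elim: k {xE} => [|k [u' Su' ek]]; first by exists 0 => //; rewrite mulr0 subr0.
    exists (u + u' - u * (y * u')).
      by apply: SB; [exact: SD|apply/SM/SM].
    by rewrite exprS ek /e; ring.
  apply: Sx; rewrite (_ : x = a + u'); first exact: SD.
  have ek0 : e ^+ k != 0 by rewrite expf_neq0.
  have : x * e ^+ k = a by rewrite xE mulfVK.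
  by rewrite ek mulrBr mulr1 mulrA mulfV// mul1r => <-; rewrite subrK.
Qed.

Let over_S (f : {poly F}) := forall i, S f`_i.

(** If neither [z] nor its inverse is in [S] then [x] is a polynomial in each.
    The relation in the inverse expresses [1] through its negative powers and
    so lowers the degree of the relation in [z]. *)
Let lower_degree z (f g : {poly F}) : z != 0 -> over_S f -> over_S g ->
  f.[z] = x -> g.[z^-1] = x -> (size g <= size f)%N -> (1 < size f)%N ->
  exists2 h : {poly F}, over_S h & (size h < size f)%N /\ h.[z] = x.
Proof.
move=> z0 Sf Sg fx gx gf f1.
have [n nE] : exists n, size f = n.+2 by exists (size f).-2; case: (size f) f1 => [|[]].
rewrite nE in gf *.
pose e := 1 - y * g`_0; have Se : S e^-1 by exact: unit_1B.
have e0 : e != 0.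
  rewrite subr_eq0; apply/eqP => yg; apply: Sx.
  by rewrite -[x]mulr1 yg mulrA mulfV// mul1r.
(* The relation in the inverse of [z], solved for 1 and multiplied by a power of [z]. *)
have zE : z ^+ n.+1 = \sum_(i < n.+1) (y * e^-1 * g`_i.+1) * z ^+ (n - i).
  have : g.[z^-1] = x by [].
  rewrite (@horner_coef_wide _ n.+2)// big_ord_recl expr0 mulr1 => gE.
  have : e = y * \sum_(i < n.+1) g`_i.+1 * z^-1 ^+ i.+1.
    by rewrite /e -[1](mulVf x0) -/y -mulrBr -{1}gE addrAC subrr add0r.
  move=> /(congr1 (fun t => e^-1 * t)); rewrite mulVf// mulrA => eE.
  rewrite -[LHS]mul1r eE -[LHS]mulrA mulr_suml mulr_sumr; apply: eq_bigr => i _.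
  rewrite [e^-1 * _]mulrC -!mulrA; do 3!congr (_ * _).
  by rewrite exprVn -[RHS]mul1r -(mulVf (expf_neq0 i.+1 z0)) -mulrA -exprD addSn subnKC ?leq_ord.
pose h := \poly_(i < n.+1) (f`_i + f`_n.+1 * (y * e^-1 * g`_(n - i).+1)).
exists h.
  move=> i; rewrite coef_poly; case: ifP => _; last exact: S0.
  by apply: SD => //; do 3!apply: SM => //.
split; first by rewrite ltnS size_poly.
rewrite -fx [RHS]horner_coef nE big_ord_recr/= zE.
rewrite (@horner_coef_wide _ n.+1) ?size_poly//.
rewrite mulr_sumr [X in _ = _ + X](reindex_inj rev_ord_inj)/= -big_split/=.
apply: eq_bigr => i _; rewrite coef_poly ltn_ord mulrDl subSS subKn ?leq_ord//.
by rewrite -[in LHS]mulrA.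
Qed.

Let valuation_ring_axiom z : z != 0 -> S z \/ S z^-1.
Proof.
suff main N : forall z (f g : {poly F}), (size f + size g < N)%N -> z != 0 ->
    ~ S z -> ~ S z^-1 -> over_S f -> over_S g -> f.[z] = x -> g.[z^-1] = x -> False.
  move=> z0; apply: contrapT => /not_orP[Sz SzV].
  suff adj t : ~ S t -> exists2 f : {poly F}, over_S f & f.[t] = x.
    have [f Sf fx] := adj _ Sz; have [g Sg gx] := adj _ SzV.
    exact: (main (size f + size g).+1 z f g).
  move=> St; pose B := [set w | exists2 f : {poly F}, over_S f & f.[t] = w].
  have SB' : S `<=` B.
    by move=> a Sa; exists a%:P; rewrite ?hornerC// => i; rewrite coefC; case: ifP.
  apply: contrapT => Bx; apply: St; apply: (maxS SB'); last first.
    by exists 'X; rewrite ?hornerX// => i; rewrite coefX; case: eqP.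
  split => //; [by move=> c; exact: SB'| | |exact: SB'].
  - move=> _ _ [f Sf <-] [g Sg <-]; exists (f - g); last by rewrite !hornerE.
    by move=> i; rewrite coefB; exact: SB.
  - move=> _ _ [f Sf <-] [g Sg <-]; exists (f * g); last by rewrite !hornerE.
    by move=> i; rewrite coefM; apply: Ssum => j _; exact: SM.
elim: N => // N IH {}z f g fgN z0 Sz SzV Sf Sg fx gx.
have size1 (h : {poly F}) t : over_S h -> h.[t] = x -> (1 < size h)%N.
  move=> Sh hx; rewrite ltnNge; apply/negP => /size1_polyC hE.
  by apply: Sx; rewrite -hx hE hornerC.
have [gf|fg] := leqP (size g) (size f).
  have [h Sh [hf hx]] := lower_degree z0 Sf Sg fx gx gf (size1 _ _ Sf fx).
  by apply: (IH z h g) => //; lia.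
have zV0 : z^-1 != 0 by rewrite invr_eq0.
rewrite -[z]invrK in fx.
have [h Sh [hg hx]] := lower_degree zV0 Sg Sf gx fx (ltnW fg) (size1 _ _ Sg gx).
rewrite invrK in fx.
by apply: (IH z f h) => //; lia.
Qed.

Let unit u := [/\ u != 0, S u & S u^-1].

Let unitM u t : unit u -> unit t -> unit (u * t).
Proof.
move=> [u0 Su Su'] [t0 St St']; split; rewrite ?mulf_neq0 ?invfM//; exact: SM.
Qed.
Let unitV u : unit u -> unit u^-1.
Proof. by move=> [u0 Su Su']; split; rewrite ?invr_eq0 ?invrK. Qed.
Let unitX u n : unit u -> unit (u ^+ n).
Proof.
by move=> [u0 Su Su']; split; rewrite ?expf_neq0// -?exprVn; exact: SX.
Qed.

Let nonunit u := u = 0 \/ S u /\ ~ S u^-1.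

Let nonunitD u t : nonunit u -> nonunit t -> nonunit (u + t).
Proof.
suff main a b : a != 0 -> b != 0 -> nonunit a -> nonunit b -> S (a / b) ->
    nonunit (a + b).
  have [->|u0] := eqVneq u 0; first by rewrite add0r.
  have [->|t0] := eqVneq t 0; first by rewrite addr0.
  have ut0 : u / t != 0 by rewrite mulf_neq0 ?invr_eq0.
  move=> nu nt; have [|] := valuation_ring_axiom ut0; first exact: main.
  by rewrite invf_div addrC; exact: main.
move=> a0 b0 [/eqP|[Sa _]]; first by rewrite (negbTE a0).
move=> [b00|[Sb NSb]] Sab; first by rewrite b00 eqxx in b0.
have [|ab0] := eqVneq (a + b) 0; [by left|right; split; first exact: SD].
move=> Sab'; apply: NSb; rewrite (_ : b^-1 = (1 + a / b) * (a + b)^-1).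
  by apply: SM => //; exact: SD.
by rewrite -[X in X + a / b](divff b0) -mulrDl addrC mulrAC divff ?mul1r.
Qed.

Let poly_in_y_order (f : {poly Fq}) : f != 0 ->
  exists k u, unit u /\ (map_poly const f).[y] = y ^+ k * u.
Proof.
elim/poly_ind: f => [|f c IH]; first by rewrite eqxx.
have -> : map_poly const (f * 'X + c%:P) = map_poly const f * 'X + (const c)%:P.
  by rewrite rmorphD rmorphM/= map_polyX map_polyC.
rewrite hornerMXaddC; have [->|c0] := eqVneq c 0.
  rewrite polyC0 addr0 mulf_eq0 polyX_eq0 orbF => /IH[k [u [uu ->]]].
  by exists k.+1, u; split=> //; rewrite rmorph0 addr0 exprSr mulrAC.
move=> _; exists 0%N, ((map_poly const f).[y] * y + const c).
rewrite expr0 mul1r; split => //.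
have cc0 : const c != 0 by rewrite fmorph_eq0.
set p := (map_poly const f).[y].
have Sp : S p.
  rewrite /p horner_coef; apply: Ssum => i _; apply: SM; last exact: SX.
  by rewrite coef_map; exact: Sc.
have -> : p * y + const c = const c * (1 - y * - (p * const c^-1)).
  by rewrite fmorphV; field.
have u0 : 1 - y * - (p * const c^-1) != 0.
  rewrite subr_eq0; apply/eqP => yp; apply: Sx; rewrite -[x]mulr1 yp mulrA.
  by rewrite mulfV// mul1r; apply/SN/SM => //; exact: Sc.
split; first by rewrite mulf_neq0.
  apply: SM; first exact: Sc.
  by apply: SB => //; apply: SM => //; apply: SN; apply: SM => //; exact: Sc.
rewrite invfM -fmorphV; apply: SM; first exact: Sc.
by apply/unit_1B/SN/SM => //; exact: Sc.
Qed.

Let minimal_term (s : seq F) a : a \in s -> (forall b, b \in s -> b != 0) ->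
  exists2 b, b \in s & forall c, c \in s -> S (c / b).
Proof.
elim: s a => // t s IH a _ s0.
have t0 : t != 0 by apply: s0; rewrite mem_head.
case: s => [|t' s] in IH s0 *.
  by exists t; rewrite ?mem_head// => c; rewrite inE => /eqP->; rewrite divff.
have [b bs bmin] := IH t' (mem_head _ _) (fun c cs => s0 c (mem_behead (s := t :: _) cs)).
have b0 : b != 0 by apply: s0; rewrite inE bs orbT.
have [|tb|bt] := @valuation_ring_axiom (t / b); first by rewrite mulf_neq0 ?invr_eq0.
  exists b; first by rewrite inE bs orbT.
  by move=> c; rewrite inE => /predU1P[->//|/bmin].
rewrite invf_div in bt; exists t; first exact: mem_head.
move=> c; rewrite inE => /predU1P[->|/bmin cb]; first by rewrite divff.
rewrite (_ : c / t = (c / b) * (b / t)); first exact: SM.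
by rewrite mulrA mulfVK.
Qed.

(** In a vanishing sum the terms of least valuation cannot be alone.  Applied
    to an algebraic relation, this makes a bounded power of [z] equal to a
    power of [y] up to a unit, so that the value group is cyclic. *)
Let power_is_power_of_y : exists2 N, (0 < N)%N & forall z, z != 0 ->
  exists k : int, unit (z ^+ N * y ^ k).
Proof.
have [n rel] := relation_bound y; exists n`!; first exact: fact_gt0.
move=> z z0; have [f [b0 fb0] sum0] := rel z.
pose term b := (map_poly const (f b)).[y] * z ^+ b.
have termE b : f b != 0 -> exists k u, unit u /\ term b = u * y ^+ k * z ^+ b.
  by move=> /poly_in_y_order[k [u [uu E]]]; exists k, u; rewrite /term E (mulrC u).
have unit0 u : unit u -> u != 0 by case.
have term0 b : f b != 0 -> term b != 0.
  move=> /termE[k [u [/unit0 u0 ->]]].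
  by rewrite !mulf_neq0// expf_neq0.
have [_ /mapP[b1 + ->] b1min] : exists2 t, t \in [seq term b | b <- enum 'I_n & f b != 0] &
    forall c, c \in [seq term b | b <- enum 'I_n & f b != 0] -> S (c / t).
  apply: (minimal_term (a := term b0)).
    by apply/mapP; exists b0; rewrite // mem_filter fb0 mem_enum.
  by move=> _ /mapP[b + ->]; rewrite mem_filter => /andP[/term0].
rewrite mem_filter => /andP[fb1 _].
have [b [bb1 fb ub]] : exists b, [/\ b != b1, f b != 0 & unit (term b / term b1)].
  apply: contrapT => noub.
  have : nonunit (\sum_(b | b != b1) term b / term b1).
    elim/big_ind: _ => [|u t|b bb1]; [by left|exact: nonunitD|].
    have [fb|fb] := eqVneq (f b) 0.
      by left; rewrite /term fb rmorph0 horner0 !mul0r.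
    right; have Sb : S (term b / term b1).
      by apply: b1min; apply/mapP; exists b; rewrite // mem_filter fb mem_enum.
    split => // Sb'; apply: noub; exists b; do 2!split => //.
    by rewrite mulf_neq0 ?invr_eq0 ?term0.
  rewrite -mulr_suml; move: sum0; rewrite (bigD1 b1)//= -/(term b1).
  move=> /eqP; rewrite addr_eq0 => /eqP t1E.
  rewrite -[X in nonunit (X / _)]opprK -t1E mulNr divff ?term0//.
  by case=> [/eqP|[_]]; rewrite ?oppr_eq0 ?oner_eq0// invrN invr1; apply; exact: SN.
have [e [k [e0 en uek]]] : exists e (k : int), [/\ (0 < e)%N, (e <= n)%N & unit (z ^+ e * y ^ k)].
  have [l [u [uu bE]]] := termE _ fb; have [l1 [u1 [uu1 b1E]]] := termE _ fb1.
  have uzy : unit (y ^ (l%:Z - l1%:Z) * (z ^+ b / z ^+ b1)).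
    have -> : y ^ (l%:Z - l1%:Z) * (z ^+ b / z ^+ b1) =
        term b / term b1 * (u^-1 * u1).
      rewrite bE b1E expfzDr// -exprnN -exprnP; field.
      by rewrite !expf_neq0 ?(unit0 _ uu) ?(unit0 _ uu1).
    exact: unitM ub (unitM (unitV uu) uu1).
  have [ltb|ltb|/val_inj eqb] := ltngtP b b1; last by rewrite eqb eqxx in bb1.
    exists (b1 - b)%N, (l1%:Z - l%:Z); split; rewrite ?subn_gt0//.
      by rewrite (leq_trans (leq_subr _ _))// ltnW.
    have := unitV uzy; rewrite invfM invf_div invr_expz opprB mulrC.
    by rewrite -{1}(subnK (ltnW ltb)) exprD mulfK ?expf_neq0.
  exists (b - b1)%N, (l%:Z - l1%:Z); split; rewrite ?subn_gt0//.
    by rewrite (leq_trans (leq_subr _ _))// ltnW.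
  by move: uzy; rewrite mulrC -{1}(subnK (ltnW ltb)) exprD mulfK ?expf_neq0.
have en' : (e %| n`!)%N by apply: dvdn_fact; rewrite e0.
exists (k * (n`! %/ e)%:Z); have := unitX (n`! %/ e) uek.
by rewrite exprMn -exprM mulnC divnK// [(y ^ k) ^+ _]exprnP exprz_exp.
Qed.

Let unit_expz_y (k : int) : unit (y ^ k) -> k = 0.
Proof.
suff main n : ~ S (y ^+ n.+1)^-1.
  case: k => [[//|n] [_ _ /main]|n [_ + _]] //.
  by rewrite NegzE -exprnN => /main.
move=> /(fun Sn => SM Sn (SX n Sy)); rewrite exprS invfM -mulrA mulVf ?expf_neq0//.
by rewrite mulr1 invrK.
Qed.

Lemma place_of_pole_ring : exists Q : place F, Q x < 0.
Proof.
have [N N0 pow] := power_is_power_of_y.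
have ex_w z (z0 : z != 0) := cid (pow z z0).
pose w z := if pselect (z != 0) is left z0 then - sval (ex_w z z0) else 0.
have wP z : z != 0 -> unit (z ^+ N * y ^ (- w z)).
  by rewrite /w; case: pselect => // z0 _; rewrite opprK; exact: (svalP (ex_w z z0)).
have wE z k : z != 0 -> unit (z ^+ N * y ^ (- k)) -> w z = k.
  move=> z0 uk; apply/eqP; rewrite -subr_eq0; apply/eqP/unit_expz_y.
  have := unitM uk (unitV (wP z z0)); rewrite invfM mulrACA mulfV ?expf_neq0// mul1r.
  by rewrite invr_expz opprK -expfzDr// addrC.
have wM a b : a != 0 -> b != 0 -> w (a * b) = w a + w b.
  move=> a0 b0; apply: wE; first exact: mulf_neq0.
  by rewrite exprMn opprD expfzDr// mulrACA; apply: unitM; exact: wP.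
have Sw z : z != 0 -> 0 <= w z -> S z.
  move=> z0 wz; have [//|SzV] := valuation_ring_axiom z0.
  have SzN : S (z ^+ N).
    have [_ Sz _] := wP z z0; have := SM Sz (SX `|w z|%N Sy).
    by rewrite -mulrA [y ^+ _]exprnP gez0_abs// -expfzDr// addNr expr0z mulr1.
  have := SM SzN (SX N.-1 SzV).
  by rewrite -[in z ^+ N](prednK N0) exprS exprVn mulfK ?expf_neq0.
have wS z : z != 0 -> S z -> 0 <= w z.
  move=> z0 Sz; rewrite leNgt; apply/negP => wz.
  have [_ _ SzV] := wP z z0; have := SM SzV (SX N Sz).
  rewrite invfM mulrAC mulVf ?expf_neq0// mul1r invr_expz opprK => Syw.
  have : S (y ^ (-1)).
    rewrite (_ : -1 = w z + (`|w z|.-1)%:Z); last by lia.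
    by rewrite expfzDr//; apply: SM => //; exact: SX.
  by rewrite exprN1 invrK.
have wD a b : a != 0 -> b != 0 -> a + b != 0 -> Num.min (w a) (w b) <= w (a + b).
  suff main c d : c != 0 -> d != 0 -> c + d != 0 -> S (c / d) ->
      Num.min (w c) (w d) <= w (c + d).
    move=> a0 b0 ab0; have ab : a / b != 0 by rewrite mulf_neq0 ?invr_eq0.
    have [|] := valuation_ring_axiom ab; first exact: main.
    by rewrite invf_div minC addrC; apply: main => //; rewrite addrC.
  move=> c0 d0 cd0 Scd; rewrite ge_min; apply/orP; right.
  have cdE : c + d = (1 + c / d) * d by rewrite mulrDl mul1r mulfVK// addrC.
  have cd1 : 1 + c / d != 0 by apply: contraNneq cd0 => cd1; rewrite cdE cd1 mul0r.
  by rewrite cdE wM// lerDr; apply: wS => //; exact: SD.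
have wy : w y = N%:Z.
  by apply: wE => //; rewrite exprnP -expfzDr// subrr expr0z; split; rewrite ?oner_eq0 ?invr1.
have [|Q [d [d0 wQ]]] := place_of_valuation wM wD.
  by exists y => //; rewrite wy.
exists Q; rewrite -[x]invrK ordV// oppr_lt0 -(pmulr_lgt0 _ d0) -wQ// wy.
by rewrite ltz_nat.
Qed.

End ValuationRing.

(** A maximal ring containing [x^-1] but not [x] is a discrete valuation ring, and
    the place it defines is a pole of [x]. *)
Lemma exists_pole : exists Q : place F, Q x < 0.
Proof. by have [S rS maxS] := maximal_pole_ring; exact: place_of_pole_ring rS maxS. Qed.

End PoleExistence.

(** * Ultrametric absolute values and the discreteness of the ring of regular functions *)

Lemma expr_unbounded (R : archiRealFieldType) (q e : R) : 1 < q -> exists n, e < q ^+ n.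
Proof.
move=> q1; have bernoulli n : 1 + (q - 1) *+ n <= q ^+ n.
  elim: n => [|n IH]; first by rewrite mulr0n addr0.
  rewrite exprS; apply: le_trans (ler_wpM2l _ IH); last by rewrite ltW// (lt_trans _ q1).
  have : 0 <= (q - 1) *+ n by rewrite mulrn_wge0// subr_ge0 ltW.
  by rewrite mulrS; set t := _ *+ n; nra.
have q10 : 0 < q - 1 by rewrite subr_gt0.
exists (Num.bound (e / (q - 1))); apply: lt_le_trans (bernoulli _).
have [e0|e0] := ltP e 0.
  by rewrite (lt_le_trans e0)// addr_ge0// mulrn_wge0// ltW.
rewrite -mulr_natr; apply: ltr_wpDl => //; rewrite mulrC -ltr_pdivrMr//.
by rewrite archi_boundP// divr_ge0// ltW.
Qed.

Section Absval.
Variables (R : realType) (K : fieldType) (v : absval R K).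

Lemma absX x n : v (x ^+ n) = v x ^+ n.
Proof. by elim: n => [|n IH]; rewrite ?expr0 ?abs1// !exprS absM IH. Qed.

Lemma absV x : v x^-1 = (v x)^-1.
Proof.
have [->|x0] := eqVneq x 0; first by rewrite invr0 abs0 invr0.
have vx0 : v x != 0 by rewrite abs_eq0.
by apply: (mulfI vx0); rewrite -absM !mulfV// abs1.
Qed.

Lemma abs_gt0 x : (0 < v x) = (x != 0).
Proof. by rewrite lt_def abs_ge0 andbT abs_eq0. Qed.

Lemma abs_prod (I : Type) (s : seq I) (p : pred I) (f : I -> K) :
  v (\prod_(i <- s | p i) f i) = \prod_(i <- s | p i) v (f i).
Proof. exact: (big_morph v (absM v) (abs1 v)). Qed.

Lemma absD_le x y c : v x <= c -> v y <= c -> v (x + y) <= c.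
Proof. by move=> xc yc; rewrite (le_trans (absD _ _ _))// ge_max xc. Qed.

Lemma absB_le x y c : v x <= c -> v y <= c -> v (x - y) <= c.
Proof. by move=> xc yc; apply: absD_le; rewrite ?absN. Qed.

Lemma abs_dist_le y x z c : v (x - y) <= c -> v (y - z) <= c -> v (x - z) <= c.
Proof. by move=> xy yz; rewrite -(subrKA y); exact: absD_le. Qed.

Lemma abs_sum_le (I : Type) (s : seq I) (p : pred I) (f : I -> K) c : 0 <= c ->
  (forall i, p i -> v (f i) <= c) -> v (\sum_(i <- s | p i) f i) <= c.
Proof. by move=> c0 fc; elim/big_ind: _ => //; [rewrite abs0|move=> x y; exact: absD_le]. Qed.

Lemma absD_lt x y : v y < v x -> v (x + y) = v x.
Proof.
move=> yx; apply/le_anti; rewrite absD_le//=; last exact: ltW.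
rewrite leNgt; apply/negP => xyx.
have : v (x + y - y) <= Num.max (v (x + y)) (v y).
  by rewrite -[in leRHS](absN v y); exact: absD.
by rewrite addrK leNgt gt_max xyx yx.
Qed.

Lemma absB_lt x y : v y < v x -> v (x - y) = v x.
Proof. by move=> yx; rewrite absD_lt// absN. Qed.

End Absval.

Section RegularAway.
Variables (Fq : finFieldType) (F : fieldExtType {fraction {poly Fq}}).
Variables (P : place F).
Local Notation A := (regular_away P).

Lemma regular_const c : A (const_rmorph F c).
Proof.
move=> Q _; have [->|c0] := eqVneq c 0; first by left; rewrite rmorph0.
by right; rewrite ord_const.
Qed.

Lemma regular1 : A 1.
Proof. by rewrite -(rmorph1 (const_rmorph F)); exact: regular_const. Qed.

Lemma regularB a b : A a -> A b -> A (a - b).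
Proof.
move=> Aa Ab Q QP; have [ab0|ab0] := eqVneq (a - b) 0; [by left|right].
apply: ordD_ge => //.
  by move=> a0; have [/eqP|//] := Aa Q QP; rewrite (negbTE a0).
by rewrite oppr_eq0 ordN => b0; have [/eqP|//] := Ab Q QP; rewrite (negbTE b0).
Qed.

Lemma regularM a b : A a -> A b -> A (a * b).
Proof.
move=> Aa Ab Q QP.
have [->|Qa] := Aa Q QP; first by left; rewrite mul0r.
have [->|Qb] := Ab Q QP; first by left; rewrite mulr0.
have [ab0|ab0] := eqVneq (a * b) 0; [by left|right].
by move: ab0; rewrite mulf_eq0 negb_or => /andP[a0 b0]; rewrite ordM// addr_ge0.
Qed.

(** A zero at [P] would come with a pole at another place. *)
Lemma regular_ord_le0 a : A a -> a != 0 -> P a <= 0.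
Proof.
move=> Aa a0; rewrite leNgt; apply/negP => Pa.
have [Q Qa] := exists_pole a0 Pa.
have [|/eqP|] := Aa Q; last by rewrite leNgt Qa.
  by move=> /(_ a a0) QP; rewrite -QP ltNge (ltW Qa) in Pa.
by rewrite (negbTE a0).
Qed.

Variable d : nat.
Hypothesis Pd : place_degree P d.

Lemma place_degree_gt0 : (0 < d)%N.
Proof.
have [b [_ bP]] := Pd; rewrite lt0n; apply/eqP => d0; move: b bP; rewrite d0 => b.
move=> /(_ 1)[|c [+ _]]; first by right; rewrite ord_1.
by rewrite big_ord0 subr0 => -[/eqP|]; rewrite ?oner_eq0// ord_1 ltxx.
Qed.

(** Successive quotients of the filtration of [A] by the order of the pole at
    [P] embed into the residue field, and the filtration starts at zero. *)
Lemma regular_bounded_poles (n : nat) : exists2 s : seq F,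
  (size s <= (#|Fq| ^ d) ^ n)%N &
  forall a, A a -> (a != 0 -> - n%:Z < P a) -> a \in s.
Proof.
elim: n => [|n [s sn sP]].
  exists [:: 0] => // a Aa Pa; rewrite inE; apply: contraT => a0.
  by have := Pa a0; rewrite oppr0 ltNge regular_ord_le0.
have [b [_ bP]] := Pd; have [t t0 Pt] := ord_surj P.
pose S a := A a /\ (a != 0 -> - n.+1%:Z < P a).
have tn0 : t ^+ n != 0 by rewrite expf_neq0.
pose code (c : {ffun 'I_d -> Fq}) a :=
  S a /\ valuation_ideal P (a * t ^+ n - \sum_k const_emb F (c k) * b k).
pose rep c := if pselect (exists a, code c a) is left h then sval (cid h) else 0.
exists [seq rep c + a | c <- enum {ffun 'I_d -> Fq}, a <- s].
  by rewrite size_allpairs -cardE card_ffun card_ord expnS leq_mul2l sn orbT.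
move=> a Aa Pa; have [|c [ca _]] := bP (a * t ^+ n).
  have [->|a0] := eqVneq a 0; first by left; rewrite mul0r.
  by right; rewrite ordM// ordX// Pt; have := Pa a0; lia.
have [Sr Ir] : code c (rep c).
  by rewrite /rep; case: pselect => [h|[]]; [exact: (svalP (cid h))|exists a].
rewrite -[a](subrKC (rep c)); apply/allpairsP; exists (c, a - rep c).
rewrite mem_enum; split => //=; apply: sP; first by apply: regularB; case: Sr.
move=> ar0; have : valuation_ideal P ((a - rep c) * t ^+ n).
  set m := \sum_k _ in ca Ir.
  have -> : (a - rep c) * t ^+ n = (a * t ^+ n - m) - (rep c * t ^+ n - m) by ring.
  move: ca Ir; set e := _ - m; set e' := _ - m => ee ee'.
  have [e0|e0] := eqVneq (e - e') 0; [by left|right].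
  have -> : (0 < P (e - e')) = (1 <= P (e - e')) by lia.
  apply: ordD_ge => //.
    by move=> ne; case: ee => [/eqP|]; [rewrite (negbTE ne)|].
  by rewrite ordN oppr_eq0 => ne; case: ee' => [/eqP|]; [rewrite (negbTE ne)|].
case=> [/eqP|]; first by rewrite mulf_eq0 (negbTE ar0) (negbTE tn0).
by rewrite ordM// ordX// Pt; lia.
Qed.

End RegularAway.

(** Counting the points of a ball through sequences without repetition does not
    presuppose that balls are finite; with [a] equal to 1, it implies it. *)
Definition growth (R : realType) (C : fieldType) (v : absval R C) (O : set C)
    (a : C) (c : nat) : Prop :=
  forall e : R, exists d : nat, forall n (s : seq C), uniq s ->
    (forall x, x \in s -> O x /\ v x <= e * v a ^+ n) -> (size s <= d * c ^ n)%N.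

Record discrete_ring (R : realType) (C : fieldType) (v : absval R C)
    (O : set C) : Prop := DiscreteRing {
  dr1 : O 1;
  drB : forall a b, O a -> O b -> O (a - b);
  drM : forall a b, O a -> O b -> O (a * b);
  dr_ge1 : forall a, O a -> a != 0 -> 1 <= v a;
  dr_growth : forall a, O a -> a != 0 -> exists c, growth v O a c }.

Section PlaceRing.
Variables (R : realType) (Fq : finFieldType) (F : fieldExtType {fraction {poly Fq}}).
Variables (P : place F) (d : nat) (Pd : place_degree P d).
Variables (C : fieldType) (v : absval R C) (i : {rmorphism F -> C}).
Hypothesis vi : forall x, v (i x) = place_abs R P #|Fq| d x.

Let q1 : 1 < #|Fq|%:R :> R.
Proof. by rewrite ltr1n finNzRing_gt1. Qed.
Let q0 : 0 < #|Fq|%:R :> R.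
Proof. exact: lt_trans q1. Qed.
Let d0 : (0 < d)%N := place_degree_gt0 Pd.

Lemma abs_place x : x != 0 -> v (i x) = #|Fq|%:R ^ (- (d%:Z * P x)).
Proof. by rewrite vi /place_abs => /negbTE->. Qed.

Lemma abs_place_small e : 0 < e -> exists2 x, x != 0 & v (i x) < e.
Proof.
move=> e0; have [t t0 Pt] := ord_surj P.
have [n ne] := expr_unbounded e^-1 q1.
exists (t ^+ n); first by rewrite expf_neq0.
rewrite abs_place ?expf_neq0// ordX// Pt.
rewrite -[e]invrK -invr_expz ltf_pV2 ?posrE ?invr_gt0 ?exprz_gt0//.
apply: lt_le_trans ne _; rewrite exprnP; apply: ler_weXz2l; first exact: ltW.
by have := d0; nia.
Qed.

Lemma place_discrete_ring : discrete_ring v (i @` regular_away P).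
Proof.
split.
- by exists 1; rewrite ?rmorph1//; exact: regular1.
- move=> _ _ [a Aa <-] [b Ab <-]; exists (a - b); last by rewrite rmorphB.
  exact: regularB.
- move=> _ _ [a Aa <-] [b Ab <-]; exists (a * b); last by rewrite rmorphM.
  exact: regularM.
- move=> _ [a Aa <-]; rewrite fmorph_eq0 => a0; rewrite abs_place//.
  rewrite -(expr0z (#|Fq|%:R : R)) ler_eXz2l//.
  by have := regular_ord_le0 Aa a0; nia.
move=> _ [a Aa <-]; rewrite fmorph_eq0 => a0.
pose m := `|P a|%N; have Pa : P a = - m%:Z by have := regular_ord_le0 Aa a0; lia.
exists ((#|Fq| ^ d) ^ m)%N => e.
have [l el] : exists l, e <= (#|Fq|%:R : R) ^+ (d * l).
  have [l el] := expr_unbounded e q1; exists l; apply: le_trans (ltW el) _.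
  by rewrite ler_eXn2l// leq_pmull.
exists ((#|Fq| ^ d) ^ l.+1)%N => n s us sP.
have [u un uP] := regular_bounded_poles Pd (l.+1 + m * n)%N.
rewrite -[((_ ^ m) ^ n)%N]expnM -expnD; apply: leq_trans un; rewrite -(size_map i u).
apply: uniq_leq_size => // x xs; have [[b Ab <-] vb] := sP x xs.
apply/map_f/uP => // b0; move: vb; rewrite !abs_place// Pa => vb.
have {vb} : (#|Fq|%:R : R) ^ (- (d%:Z * P b)) <= #|Fq|%:R ^ ((d * l)%:Z + d%:Z * m%:Z * n%:Z).
  apply: le_trans vb _; rewrite mulrN opprK [_ ^+ n]exprnP exprz_exp.
  by rewrite expfzDr ?gt_eqF// ler_wpM2r ?exprz_ge0// ltW.
by rewrite ler_eXz2l//; have := d0; nia.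
Qed.

End PlaceRing.

(** * Discrete modules: ranks and numbers of points in balls *)

Lemma leq_of_expn_bound (M N K : nat) :
  (forall n, (M ^ n <= K * N ^ n)%N) -> (M <= N)%N.
Proof.
case: N => [/(_ 1%N)|N MN]; first by rewrite muln0.
rewrite leqNgt; apply/negP => ltNM.
have bernoulli n : (N.+1 ^ n * (N.+1 + n) <= N.+2 ^ n * N.+1)%N.
  elim: n => [|n IH]; first by rewrite !expn0 addn0.
  by rewrite !expnS; nia.
have := MN (K * N.+1)%N; have := bernoulli (K * N.+1)%N.
set n := (K * N.+1)%N => le1 le2.
have le3 : (N.+2 ^ n <= M ^ n)%N by case: n {le1 le2} => [|n]; rewrite ?expn0// leq_exp2r.
have : (N.+1 ^ n * (N.+1 + n) <= N.+1 ^ n * n)%N.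
  apply: (leq_trans le1); apply: (leq_trans (leq_mul (leq_trans le3 le2) (leqnn _))).
  by rewrite mulnAC mulnC /n.
by rewrite leq_pmul2l ?expn_gt0//; lia.
Qed.

Section Modules.
Variables (R : realType) (C : fieldType) (v : absval R C) (O : set C).
Hypothesis dO : discrete_ring v O.

Let O1 : O 1 := dr1 dO.
Let OB := drB dO.
Let OM := drM dO.
Let O0 : O 0. Proof. by rewrite -(subrr 1); exact: OB. Qed.
Let ON a : O a -> O (- a). Proof. by move=> Oa; rewrite -sub0r; exact: OB. Qed.
Let OD a b : O a -> O b -> O (a + b).
Proof. by move=> Oa Ob; rewrite -[b]opprK; apply/OB/ON. Qed.
Let OX a n : O a -> O (a ^+ n).
Proof. by move=> Oa; elim: n => [|n IH]; rewrite ?expr0// exprS; exact: OM. Qed.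
Let Osum (I : finType) (f : I -> C) : (forall k, O (f k)) -> O (\sum_k f k).
Proof. by move=> Of; elim/big_rec: _ => // k a _; exact: OD. Qed.
Let Oprod (I : finType) (p : pred I) (f : I -> C) :
  (forall k, O (f k)) -> O (\prod_(k | p k) f k).
Proof. by move=> Of; elim/big_rec: _ => // k a _; exact: OM. Qed.

Record submodule (L : set C) : Prop := Submodule {
  sm0 : L 0;
  smB : forall x y, L x -> L y -> L (x - y);
  smZ : forall a x, O a -> L x -> L (a * x) }.

Lemma smD L x y : submodule L -> L x -> L y -> L (x + y).
Proof.
move=> mL Lx Ly; rewrite -[y]opprK; apply: smB => //.
by rewrite -sub0r; apply: smB => //; exact: sm0.
Qed.

Lemma sm_sum L (I : finType) (f : I -> C) : submodule L ->
  (forall k, L (f k)) -> L (\sum_k f k).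
Proof.
by move=> mL Lf; elim/big_rec: _ => [|k a _ La]; [exact: sm0|exact: smD].
Qed.

Lemma ring_submodule : submodule O.
Proof. by split. Qed.

Definition O_span n (g : 'I_n -> C) : set C :=
  [set z | exists2 a : 'I_n -> C, (forall k, O (a k)) & z = \sum_k a k * g k].

Definition O_free n (b : 'I_n -> C) : Prop :=
  forall a : 'I_n -> C, (forall k, O (a k)) ->
    \sum_k a k * b k = 0 -> forall k, a k = 0.

Definition rank_le (L : set C) r : Prop :=
  forall b : 'I_r.+1 -> C, (forall k, L (b k)) -> ~ O_free b.

Lemma span_submodule n (g : 'I_n -> C) : submodule (O_span g).
Proof.
split.
- by exists (fun=> 0) => //; rewrite big1// => k _; rewrite mul0r.
- move=> _ _ [a Oa ->] [b Ob ->]; exists (fun k => a k - b k) => [k|]; first exact: OB.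
  by rewrite -sumrB; apply: eq_bigr => k _; rewrite mulrBl.
- move=> c _ Oc [a Oa ->]; exists (fun k => c * a k) => [k|]; first exact: OM.
  by rewrite mulr_sumr; apply: eq_bigr => k _; rewrite mulrA.
Qed.

Lemma span_gen n (g : 'I_n -> C) k : O_span g (g k).
Proof.
exists (fun l => (l == k)%:R) => [l|]; first by case: eqP.
rewrite (bigD1 k)//= eqxx mul1r big1 ?addr0// => l /negbTE->.
by rewrite mul0r.
Qed.

Definition fcons n (x : C) (b : 'I_n -> C) (k : 'I_n.+1) : C :=
  if unlift ord0 k is Some l then b l else x.

Lemma fcons_sum n x (b : 'I_n -> C) (a : 'I_n.+1 -> C) :
  \sum_k a k * fcons x b k = a ord0 * x + \sum_k a (lift ord0 k) * b k.
Proof.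
rewrite big_ord_recl /fcons unlift_none; congr (_ + _).
by apply: eq_bigr => k _; rewrite liftK.
Qed.

Lemma fconsP (S : set C) n x (b : 'I_n -> C) :
  S x -> (forall k, S (b k)) -> forall k, S (fcons x b k).
Proof. by move=> Sx Sb k; rewrite /fcons; case: unliftP => [l|] _. Qed.

(** Take for [b] a free family which cannot be prolonged: prolonging it by [x] gives
    a relation, in which [x] has a nonzero coefficient. *)
Lemma maximal_free L r : rank_le L r -> exists s (b : 'I_s -> C),
  [/\ (s <= r)%N, (forall k, L (b k)), O_free b, rank_le L s &
   forall x, L x -> exists a, [/\ O a, a != 0 & O_span b (a * x)]].
Proof.
move=> rL; pose p s := `[< exists2 b : 'I_s -> C, (forall k, L (b k)) & O_free b >].
have np : exists s, ~~ p s by exists r.+1; apply/asboolPn => -[b /rL]; exact.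
have /ex_minnP[[|s] nps mins] := np.
  by case/negP: nps; apply/asboolP; exists (fun=> 0) => [|a _ _] [].
have sr : (s <= r)%N by rewrite -ltnS; apply: mins; apply/asboolPn => -[b /rL]; exact.
have rs : rank_le L s by move=> b Lb fb; case/negP: nps; apply/asboolP; exists b.
have /asboolP[b Lb fb] : p s by apply: contraT => /mins; rewrite ltnn.
exists s, b; split => // x Lx.
apply: contrapT => nx; apply: (rs (fcons x b)); first exact: fconsP.
move=> a Oa; rewrite fcons_sum => sum0.
have [a0|a0] := eqVneq (a ord0) 0.
  rewrite a0 mul0r add0r in sum0 => k.
  have [l ->|-> //] := unliftP ord0 k.
  exact: (fb (fun l => a (lift ord0 l))).
exfalso; apply: nx; exists (a ord0); split => //.
exists (fun k => - a (lift ord0 k)) => [k|]; first exact: ON.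
apply/eqP; rewrite -subr_eq0; apply/eqP; rewrite -[RHS]sum0; congr (_ + _).
by rewrite -sumrN; apply: eq_bigr => k _; rewrite mulNr opprK.
Qed.

Definition distinct_mod (L : set C) (a : C) M (x : 'I_M -> C) : Prop :=
  forall k l, (exists2 y, L y & x k - x l = a * y) -> k = l.

Lemma complete_residues L a K : L 0 ->
  (forall M (x : 'I_M -> C), (forall k, L (x k)) -> distinct_mod L a x -> (M <= K)%N) ->
  (forall y, L y -> L (- y)) ->
  exists M (x : 'I_M -> C), [/\ (M <= K)%N, forall k, L (x k), distinct_mod L a x &
    forall z, L z -> exists k, exists2 y, L y & z = x k + a * y].
Proof.
move=> L0 bnd LN.
pose p M := `[< exists2 x : 'I_M -> C, (forall k, L (x k)) & distinct_mod L a x >].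
have np : exists M, ~~ p M.
  by exists K.+1; apply/asboolPn => -[x Lx /(bnd _ _ Lx)]; rewrite ltnn.
have /ex_minnP[[|M] npM minM] := np.
  by case/negP: npM; apply/asboolP; exists (fun=> 0) => [|[]].
have /asboolP[x Lx dx] : p M by apply: contraT => /minM; rewrite ltnn.
exists M, x; split => //; first exact: (bnd _ x).
move=> z Lz; apply: contrapT => nz; case/negP: npM; apply/asboolP.
exists (fcons z x); first exact: fconsP.
move=> k l [y Ly]; rewrite /fcons.
case: unliftP => [k' ->|->]; case: unliftP => [l' ->|->] // E.
- by congr lift; apply: dx; exists y.
- exfalso; apply: nz; exists k', (- y); first exact: LN.
  by rewrite mulrN -E opprB addrC subrK.
- by exfalso; apply: nz; exists l', y => //; rewrite -E addrC subrK.
Qed.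

(** Reduction modulo [a] recovers the first digit of an expansion in base [a]. *)
Lemma digits_inj L a M (x : 'I_M -> C) n (f g : 'I_n -> 'I_M) :
  submodule L -> O a -> a != 0 -> (forall k, L (x k)) -> distinct_mod L a x ->
  \sum_(t < n) a ^+ t * x (f t) = \sum_(t < n) a ^+ t * x (g t) -> f =1 g.
Proof.
move=> mL Oa a0 Lx dx; elim: n => [|n IH] in f g *; first by move=> _ [].
have step h : \sum_(t < n.+1) a ^+ t * x (h t) =
    x (h ord0) + a * \sum_(t < n) a ^+ t * x (h (lift ord0 t)).
  rewrite big_ord_recl expr0 mul1r mulr_sumr; congr (_ + _).
  by apply: eq_bigr => t _; rewrite mulrA -exprS.
have Lsum h : L (\sum_(t < n) a ^+ t * x (h (lift ord0 t))).
  by apply: sm_sum => // t; apply: smZ => //; exact: OX.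
rewrite !step => E.
have fg0 : f ord0 = g ord0.
  apply: dx; eexists; first exact: smB (Lsum g) (Lsum f).
  by rewrite mulrBr; move/eqP: E; rewrite -subr_eq => /eqP <-; ring.
move: E; rewrite fg0 => /addrI/(mulfI a0)/IH fg t.
by have [u ->|->] := unliftP ord0 t; [exact: fg|].
Qed.

Local Notation growth := (growth v O).

(** The [n]-digit expansions in base [a] lie in a box of the ambient free module
    of rank at most [r], so the number [M] of digits satisfies
    [M ^ n <= (d * c ^ n) ^ r] for all [n]. *)
Lemma residues_bound L r a c M (x : 'I_M -> C) :
  submodule L -> rank_le L r -> O a -> a != 0 -> growth a c ->
  (forall k, L (x k)) -> distinct_mod L a x -> (M <= c ^ r)%N.
Proof.
move=> mL rL Oa a0 ga Lx dx.
have [s [b [sr Lb fb _ bP]]] := maximal_free rL.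
have /(_ _)/cid-/all_sig[d dP] k : exists d, [/\ O d, d != 0 & O_span b (d * x k)] by exact: bP.
pose D := \prod_k d k.
have D0 : D != 0 by apply/prodf_neq0 => k _; have [] := dP k.
have /(_ _)/cid2-/all_sig2[A OA AE] k : O_span b (D * x k).
  rewrite /D (bigD1 k)//= mulrAC mulrC; apply: smZ; first exact: span_submodule.
    by apply: Oprod => l; have [] := dP l.
  by have [] := dP k.
pose e := \sum_k \sum_l v (A k l).
have Ae k l : v (A k l) <= e.
  rewrite /e (bigD1 k)//= (bigD1 l)//= -addrA lerDl.
  by apply: addr_ge0; do ?(apply: sumr_ge0 => ? _); exact: abs_ge0.
have e0 : 0 <= e by do 2!(apply: sumr_ge0 => ? _); exact: abs_ge0.
have va : 1 <= v a by exact: dr_ge1 dO _ Oa a0.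
have [m mP] := ga e; apply: (@leq_of_expn_bound _ _ (m ^ r)) => n.
pose G (f : {ffun 'I_n -> 'I_M}) l := \sum_(t < n) a ^+ t * A (f t) l.
have GE (f : {ffun 'I_n -> 'I_M}) : D * \sum_(t < n) a ^+ t * x (f t) = \sum_l G f l * b l.
  rewrite mulr_sumr; under eq_bigr => t _ do rewrite mulrCA AE mulr_sumr.
  rewrite exchange_big/=; apply: eq_bigr => l _; rewrite mulr_suml.
  by apply: eq_bigr => t _; rewrite mulrA.
have GP f l : O (G f l) /\ v (G f l) <= e * v a ^+ n.
  split; first by apply: Osum => t; apply: OM; [exact: OX|exact: OA].
  apply: abs_sum_le => [|t _]; first by rewrite mulr_ge0// exprn_ge0// abs_ge0.
  rewrite absM absX mulrC ler_pM ?abs_ge0 ?exprn_ge0 ?abs_ge0//.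
  by rewrite ler_weXn2l// ltnW.
pose u := undup [seq G p.1 p.2 | p <- enum (({ffun 'I_n -> 'I_M} * 'I_s)%type : finType)].
have uG f l : G f l \in u.
  by rewrite mem_undup; apply/mapP; exists (f, l); rewrite ?mem_enum.
have um : (size u <= m * c ^ n)%N.
  by apply: mP; [exact: undup_uniq|move=> _ /[!mem_undup]/mapP[p _ ->]].
have mc0 : (0 < m * c ^ n)%N.
  apply: (mP n [:: 0]) => // _ /[!inE]/eqP->; split => //.
  by rewrite abs0 mulr_ge0// exprn_ge0// abs_ge0.
pose h f : {ffun 'I_s -> 'I_(size u)} :=
  [ffun l => Ordinal (etrans (index_mem (G f l) u) (uG f l))].
have /leq_card : injective h.
  move=> f g /ffunP fg; have Gfg l : G f l = G g l.
    have := fg l; rewrite !ffunE => /(congr1 val)/= E.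
    by rewrite -(nth_index 0 (uG f l)) E nth_index.
  apply/ffunP; apply: (digits_inj mL Oa a0 Lx dx).
  by apply: (mulfI D0); rewrite !GE; apply: eq_bigr => l _; rewrite Gfg.
rewrite !card_ffun !card_ord => /leq_trans; apply.
rewrite -[((c ^ r) ^ n)%N]expnM (mulnC r n) expnM -expnMn.
apply: (@leq_trans ((m * c ^ n) ^ s)); last exact: leq_pexp2l.
by case: (s) => [|t]; rewrite ?expn0// leq_exp2r.
Qed.

Definition discrete (L : set C) : Prop :=
  forall rho : R, finite_set (L `&` [set z | v z <= rho]).

Definition ball_points (L : set C) (rho : R) : {fset C} :=
  fset_set (L `&` [set z | v z <= rho]).

Lemma ball_pointsP L rho z : discrete L ->
  reflect (L z /\ v z <= rho) (z \in ball_points L rho).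
Proof. by move=> dL; rewrite in_fset_set//; apply: (iffP idP) => [/set_mem|/mem_set]. Qed.

Lemma card_ball_points_ge L rho (s : seq C) : discrete L -> uniq s ->
  (forall x, x \in s -> L x /\ v x <= rho) -> (size s <= #|` ball_points L rho|)%N.
Proof. by move=> dL us sP; apply: uniq_leq_size => // x /sP /(ball_pointsP _ _ dL). Qed.

Lemma card_ball_points_le L rho (s : seq C) : discrete L ->
  (forall x, L x -> v x <= rho -> x \in s) -> (#|` ball_points L rho| <= size s)%N.
Proof.
move=> dL sP; apply: uniq_leq_size => [|x /(ball_pointsP _ _ dL)[]]; last exact: sP.
exact: fset_uniq.
Qed.

Lemma ring_discrete : discrete O.
Proof.
move=> rho; apply: contrapT => inf.
have [c /(_ rho)[d dP]] := dr_growth dO O1 (oner_neq0 C).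
have [B Bsub] := infinite_set_fset (d * c ^ 0).+1 inf.
rewrite ltnNge => /negP; apply; apply: dP; first exact: fset_uniq.
by move=> x /Bsub[Ox]; rewrite expr0 mulr1.
Qed.

Let N rho := #|` ball_points O rho|.

Lemma seq_abs_bounded (s : seq C) : exists2 rho : R, 0 < rho &
  forall x, x \in s -> v x <= rho.
Proof.
elim: s => [|y s [rho rho0 sP]]; first by exists 1.
exists (rho + v y) => [|x]; first by rewrite ltr_wpDr ?abs_ge0.
rewrite inE => /predU1P[->|/sP xr]; first by rewrite lerDr ltW.
by rewrite (le_trans xr)// lerDl abs_ge0.
Qed.

Lemma free_combinations L n (b : 'I_n -> C) (S : {fset C}) beta rho :
  submodule L -> discrete L -> (forall k, L (b k)) -> O_free b ->
  (forall a, a \in S -> O a /\ v a <= rho) -> (forall k, v (b k) <= beta) ->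
  0 <= beta -> 0 <= rho -> (#|` S| ^ n <= #|` ball_points L (beta * rho)|)%N.
Proof.
move=> mL dL Lb fb SP bb beta0 rho0.
have -> : (#|` S| ^ n = #|{ffun 'I_n -> S}|)%N by rewrite card_ffun card_ord cardfE.
pose G (f : {ffun 'I_n -> S}) := \sum_k val (f k) * b k.
rewrite cardE -(size_map G); apply: card_ball_points_ge => //.
  rewrite map_inj_uniq ?enum_uniq// => f g fg.
  apply/ffunP => k; apply/val_inj/eqP; rewrite -subr_eq0; apply/eqP.
  apply: (fb (fun k => val (f k) - val (g k))).
    by move=> l; apply: OB; [have [] := SP _ (valP (f l))|have [] := SP _ (valP (g l))].
  by under eq_bigr do rewrite mulrBl; rewrite sumrB -/(G f) -/(G g) fg subrr.
move=> _ /mapP[f _ ->]; split.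
  by apply: sm_sum => // k; apply: smZ => //; have [] := SP _ (valP (f k)).
apply: abs_sum_le => [|k _]; first exact: mulr_ge0.
by rewrite absM mulrC ler_pM ?abs_ge0//; have [] := SP _ (valP (f k)).
Qed.

Section InfiniteRing.
Variable T : C.
Hypotheses (OT : O T) (vT : 1 < v T).

Let vT0 : 0 < v T. Proof. exact: lt_trans vT. Qed.
Let T0 : T != 0. Proof. by rewrite -(abs_gt0 v). Qed.

(** Let [x] run through the [Q] classes of [O] modulo [T], finite in number by
    [residues_bound].  Once [rho] exceeds the representatives, the [x + T * a] with
    [a] in the ball of radius [rho] run exactly once through the ball of radius
    [rho * v T]. *)
Lemma ring_ball_growth : exists Q (rho0 : R), [/\ (1 < Q)%N, 0 < rho0 &
  forall n, N (rho0 * v T ^+ n) = (Q ^ n * N rho0)%N].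
Proof.
have [c gc] := dr_growth dO OT T0.
have rO : rank_le O 1.
  move=> b Ob fb; pose b1 := b (lift ord0 ord0).
  have b0 : forall k : 'I_2, fcons b1 (fun=> - b ord0) k = 0.
    apply: (fb (fcons b1 (fun=> - b ord0))); first by apply: fconsP; [exact: Ob|move=> _; exact: ON].
    by rewrite big_ord_recl big_ord1 /fcons unlift_none liftK /b1; ring.
  have bz : \sum_k 1 * b k = 0.
    rewrite big_ord_recl big_ord1 !mul1r.
    have := b0 ord0; rewrite /fcons unlift_none -/b1 => ->.
    by have := b0 (lift ord0 ord0); rewrite /fcons liftK => /eqP; rewrite oppr_eq0 => /eqP->; rewrite addr0.
  by have /eqP := fb (fun=> 1) (fun=> O1) bz ord0; rewrite oner_eq0.
have [|||Q [x [Qc Ox dx cx]]] := @complete_residues O T (c ^ 1) => //.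
  by move=> M x Ox dx; exact: (residues_bound ring_submodule rO OT T0 gc Ox dx).
have [rho0 rho00 xr] := seq_abs_bounded [seq x k | k : 'I_Q].
have Q1 : (1 < Q)%N.
  have [k0 [y0 Oy0 E0]] := cx _ O0; have [k1 [y1 Oy1 E1]] := cx _ O1.
  rewrite ltnNge; apply/negP => Q1; have k01 : k1 = k0.
    by apply: val_inj; case: k0 k1 {E0 E1} => [k0 ?] [k1 ?] /=; lia.
  have E : 1 = T * (y1 - y0) by rewrite mulrBr -[LHS]subr0 E1 E0 k01; ring.
  have y0' : y1 - y0 != 0 by apply/eqP => y; have := oner_neq0 C; rewrite E y mulr0 eqxx.
  have vy := dr_ge1 dO (OB Oy1 Oy0) y0'.
  have /eqP := congr1 v E; rewrite abs1 absM lt_eqF// (lt_le_trans vT)//.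
  by rewrite ler_peMr// ltW.
exists Q, rho0; split => //.
suff step rho : rho0 <= rho -> N (rho * v T) = (Q * N rho)%N.
  elim => [|n IH]; first by rewrite expr0 mulr1 mul1n.
  rewrite exprSr mulrA step ?IH ?expnS ?mulnA// ler_peMr ?exprn_ege1//.
    by rewrite ltW.
  by rewrite ltW.
move=> rr; have rho_ge0 : 0 <= rho by rewrite (le_trans _ rr)// ltW.
pose s := [seq x k + T * a | k <- enum 'I_Q, a <- ball_points O rho].
have ss : size s = (Q * N rho)%N by rewrite size_allpairs size_enum_ord.
apply/eqP; rewrite -ss eqn_leq card_ball_points_le ?card_ball_points_ge//.
- exact: ring_discrete.
- apply: allpairs_uniq; [exact: enum_uniq|exact: fset_uniq|].
  move=> [k a] [l b] /allpairsP[[k' a'] [_ /(ball_pointsP _ _ ring_discrete)[Oa _] [-> ->]]].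
  move=> /allpairsP[[l' b'] [_ /(ball_pointsP _ _ ring_discrete)[Ob _] [-> ->]]] /= E.
  have kl : k' = l'.
    apply: dx; exists (b' - a'); first exact: OB.
    by move/eqP: E; rewrite mulrBr -subr_eq => /eqP <-; ring.
  by move: E; rewrite kl => /addrI/(mulfI T0)->.
- move=> _ /allpairsP[[k a] [_ /(ball_pointsP _ _ ring_discrete)[Oa ra] ->]]/=.
  split; first by apply: OD => //; exact: OM.
  apply: absD_le.
    rewrite (le_trans (xr _ _)) ?map_f ?mem_enum//.
    by rewrite (le_trans rr)// ler_peMr// ltW.
  by rewrite absM mulrC ler_wpM2r// ltW.
- exact: ring_discrete.
- move=> z Oz rz; have [k [y Oy zE]] := cx z Oz.
  apply/allpairsP; exists (k, y); split; [by rewrite mem_enum| |by []].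
  apply/(ball_pointsP _ _ ring_discrete); split => //=.
  rewrite -(ler_pM2r vT0) mulrC -absM (_ : T * y = z - x k); last by rewrite zE addrC addKr.
  apply: absB_le => //; rewrite (le_trans (xr _ _)) ?map_f ?mem_enum//.
  by rewrite (le_trans rr)// ler_peMr// ltW.
Qed.

(** [Q] governs both the number of points of [O] in large balls and, by
    [residues_bound], the index of [T * L] in [L]. *)
Lemma ring_ball_growthP : exists Q (rho0 : R), [/\ (1 < Q)%N, 0 < rho0,
  forall n, N (rho0 * v T ^+ n) = (Q ^ n * N rho0)%N &
  forall k, growth (T ^+ k) (Q ^ k)].
Proof.
have [Q [rho0 [Q1 rho00 NQ]]] := ring_ball_growth.
exists Q, rho0; split => // k e.
have [l el] := expr_unbounded (e / rho0) vT; rewrite ltr_pdivrMr// mulrC in el.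
exists (Q ^ l * N rho0)%N => n s us sP.
rewrite -expnM mulnAC -expnD -NQ; apply: card_ball_points_ge => // [|x /sP[Ox xe]].
  exact: ring_discrete.
split => //; apply: (le_trans xe); rewrite exprD mulrA absX exprM.
by rewrite ler_wpM2r ?ltW// !exprn_gt0.
Qed.

Lemma index_bound L r Q k M (x : 'I_M -> C) : submodule L -> rank_le L r ->
  growth (T ^+ k) (Q ^ k) -> (forall k, L (x k)) -> distinct_mod L (T ^+ k) x ->
  (M <= (Q ^ k) ^ r)%N.
Proof.
by move=> mL rL gk; apply: residues_bound => //; [exact: OX|rewrite expf_neq0].
Qed.

(** Modulo [T ^+ k] with [k] about [log rho], the points of the ball of radius [rho]
    are distinct, so there are at most [(Q ^ k) ^ r] of them.  A free family of
    [r.+1] elements would produce about [(Q ^ k) ^ r.+1] points. *)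
Lemma count_bound_infinite (s : R) r : 0 < s -> exists K : R -> nat,
  (forall L, submodule L -> discrete L -> rank_le L r ->
    (forall l, L l -> l != 0 -> s <= v l) ->
    forall rho, (#|` ball_points L rho| <= K rho)%N) /\
  (forall L, submodule L -> discrete L ->
    (forall rho, #|` ball_points L rho| <= K rho)%N -> rank_le L r).
Proof.
move=> s0; have [Q [rho0 [Q1 rho00 NQ gQ]]] := ring_ball_growthP.
have exk rho : exists k, rho < s * v T ^+ k.
  by have [k] := expr_unbounded (rho / s) vT; rewrite ltr_pdivrMr// mulrC; exists k.
pose k0 rho := ex_minn (exk rho).
have k0P rho : rho < s * v T ^+ k0 rho by rewrite /k0; case: ex_minnP.
exists (fun rho => (Q ^ k0 rho) ^ r)%N; split.
  move=> L mL dL rL Ls rho; set B := ball_points L rho.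
  have BP (k : 'I_(#|` B|)) : B`_k \in B by rewrite mem_nth.
  apply: (index_bound (x := fun k => B`_k) mL rL (gQ _)).
    by move=> k; have /(ball_pointsP _ _ dL)[] := BP k.
  move=> k l [y Ly E]; apply/val_inj/eqP.
  rewrite -(nth_uniq 0 (ltn_ord k) (ltn_ord l) (fset_uniq B)) -subr_eq0.
  apply: contraT => kl0; have : v (B`_k - B`_l) <= rho.
    by apply: absB_le; [have /(ball_pointsP _ _ dL)[] := BP k|have /(ball_pointsP _ _ dL)[] := BP l].
  rewrite leNgt => /negP; case; apply: (lt_le_trans (k0P rho)).
  rewrite E absM absX mulrC ler_wpM2l ?exprn_ge0 ?abs_ge0//.
  by apply: Ls => //; apply: contraNneq kl0 => y0; rewrite E y0 mulr0.
move=> L mL dL LK b Lb fb.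
have [beta beta0 bb] := seq_abs_bounded [seq b k | k : 'I_r.+1].
pose k1 := k0 (beta * rho0); pose n := (r * k1).+1.
have k0n : (k0 (beta * (rho0 * v T ^+ n))%R <= n + k1)%N.
  rewrite /k0; case: ex_minnP => k _; apply.
  by rewrite mulrA addnC exprD mulrA ltr_pM2r ?exprn_gt0// k0P.
have := @free_combinations L _ b (ball_points O (rho0 * v T ^+ n)) beta
  (rho0 * v T ^+ n) mL dL Lb fb.
rewrite -/(N _) NQ => /(_ _ _ _ _)/leq_trans/(_ (LK _)) H.
have : ((Q ^ n * N rho0) ^ r.+1 <= (Q ^ k0 (beta * (rho0 * v T ^+ n))%R) ^ r)%N.
  apply: H; [|by move=> k; apply: bb; rewrite map_f ?mem_enum|exact: ltW|].
    by move=> a /(ball_pointsP _ _ ring_discrete).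
  by rewrite mulr_ge0 ?exprn_ge0 ?ltW.
rewrite leqNgt => /negP; apply; apply: (@leq_trans ((Q ^ n) ^ r.+1)); last first.
  rewrite leq_exp2r// leq_pmulr// /N cardfs_gt0; apply/fset0Pn; exists 0.
  by apply/(ball_pointsP _ _ ring_discrete); rewrite abs0 ltW.
rewrite -!expnM ltn_exp2l//; apply: (@leq_ltn_trans ((n + k1) * r)).
  exact: leq_mul.
by rewrite mulnDl mulnSr ltn_add2l mulnC.
Qed.

(** Let [rho] bound representatives of [L / T L], which is finite.  Subtracting a
    representative and dividing by [T] shrinks any element of [L] down to the ball
    of radius [rho], so the points of this ball generate. *)
Lemma discrete_finitely_generated_infinite L r : submodule L -> discrete L ->
  rank_le L r -> exists n (g : 'I_n -> C), L = O_span g.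
Proof.
move=> mL dL rL; have [Q [rho0 [Q1 _ _ gQ]]] := ring_ball_growthP.
have LN y : L y -> L (- y) by move=> Ly; rewrite -sub0r; apply: smB => //; exact: sm0.
have [|M [x [_ Lx _ cx]]] := @complete_residues L (T ^+ 1) ((Q ^ 1) ^ r) (sm0 mL) _ LN.
  by move=> M x Lx; exact: index_bound.
have [rho rho_gt0 xr] := seq_abs_bounded [seq x k | k : 'I_M].
pose B := ball_points L rho; pose g (k : 'I_(#|` B|)) := B`_k.
have Bg z : z \in B -> O_span g z.
  move=> zB; have kB : (index z B < #|` B|)%N by rewrite index_mem.
  by have := span_gen g (Ordinal kB); rewrite /g/= nth_index.
exists _, g; apply/seteqP; split => z; last first.
  move=> [a Oa ->]; apply: sm_sum => // k; apply: smZ => //.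
  by have /(ball_pointsP _ _ dL)[] : B`_k \in B by rewrite mem_nth.
move=> Lz; have [n zn] : exists n, v z <= rho * v T ^+ n.
  have [n] := expr_unbounded (v z / rho) vT.
  by rewrite ltr_pdivrMr// mulrC => /ltW; exists n.
elim: n z Lz zn => [|n IH] z Lz zn.
  by apply: Bg; apply/(ball_pointsP _ _ dL); rewrite expr0 mulr1 in zn.
have [k [y Ly zE]] := cx z Lz; rewrite expr1 in zE.
have xk : v (x k) <= rho by apply: xr; rewrite map_f ?mem_enum.
have mg := span_submodule g.
rewrite zE; apply: smD => //; first by apply: Bg; apply/(ball_pointsP _ _ dL).
apply: smZ => //; apply: IH => //; rewrite -(ler_pM2r vT0) mulrC -absM -mulrA -exprSr.
rewrite (_ : T * y = z - x k); last by rewrite zE addrC addKr.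
by apply: absB_le => //; rewrite (le_trans xk)// ler_peMr ?exprn_ege1 ?ltW.
Qed.

End InfiniteRing.

Section FiniteRing.
Hypothesis O_bounded : forall a, O a -> v a <= 1.

Let S := ball_points O 1.

Let mem_S a : O a -> a \in S.
Proof. by move=> Oa; apply/(ball_pointsP _ _ ring_discrete); split => //; exact: O_bounded. Qed.

(** A finite domain is a field. *)
Let O_inv a : O a -> a != 0 -> O a^-1.
Proof.
move=> Oa a0; pose f (x : S) : S := [` mem_S (OM Oa (proj1 (elimT (ball_pointsP _ _ ring_discrete) (valP x))))]%fset.
have [g gK fK] : bijective f.
  apply: injF_bij => x y /(congr1 val)/= /(mulfI a0); exact: val_inj.
have := fK [` mem_S O1]%fset => /(congr1 val)/= E.
have := valP (g [` mem_S O1]%fset) => /(ball_pointsP _ _ ring_discrete)[+ _].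
by rewrite -[val _](mulKf a0) E mulr1.
Qed.

Lemma free_basis_finite L r : submodule L -> rank_le L r ->
  exists s (b : 'I_s -> C), (s <= r)%N /\ L = O_span b.
Proof.
move=> mL rL; have [s [b [sr Lb fb _ bP]]] := maximal_free rL.
exists s, b; split => //; apply/seteqP; split => z; last first.
  by move=> [a Oa ->]; apply: sm_sum => // k; exact: smZ.
move=> /bP[a [Oa a0 /(smZ (span_submodule b) (O_inv Oa a0))]].
by rewrite mulKf.
Qed.

Lemma count_bound_finite r : exists K : nat,
  (forall L, submodule L -> discrete L -> rank_le L r ->
    forall rho, (#|` ball_points L rho| <= K)%N) /\
  (forall L, submodule L -> discrete L ->
    (forall rho, #|` ball_points L rho| <= K)%N -> rank_le L r).
Proof.
have S1 : (1 < #|` S|)%N.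
  rewrite -[2%N]/(size [:: 0; 1 : C]); apply: card_ball_points_ge.
  - exact: ring_discrete.
  - by rewrite /= inE eq_sym oner_eq0.
  - by move=> x; rewrite !inE => /orP[]/eqP->; rewrite ?abs0 ?abs1.
exists (#|` S| ^ r)%N; split.
  move=> L mL dL rL rho; have [s [b [sr LE]]] := free_basis_finite mL rL.
  apply: (@leq_trans (#|` S| ^ s)); last by rewrite leq_pexp2l// ltnW.
  have -> : (#|` S| ^ s = #|{ffun 'I_s -> S}|)%N by rewrite card_ffun card_ord cardfE.
  rewrite cardE -(size_map (fun f : {ffun 'I_s -> S} => \sum_k val (f k) * b k)).
  apply: card_ball_points_le => // x; rewrite LE => -[a Oa ->] _.
  apply/mapP; exists [ffun k => [` mem_S (Oa k)]%fset]; rewrite ?mem_enum//.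
  by apply: eq_bigr => k _; rewrite ffunE.
move=> L mL dL LK b Lb fb.
have [beta beta0 bb] := seq_abs_bounded [seq b k | k : 'I_r.+1].
have := @free_combinations L _ b S beta 1 mL dL Lb fb.
move=> /(_ _ _ _ _)/leq_trans/(_ (LK _)) H.
have : (#|` S| ^ r.+1 <= #|` S| ^ r)%N.
  apply: H; [|by move=> k; apply: bb; rewrite map_f ?mem_enum|exact: ltW|exact: ler01].
  by move=> a /(ball_pointsP _ _ ring_discrete).
by rewrite leq_exp2l// ltnn.
Qed.

End FiniteRing.

Lemma ring_bounded_or : (forall a, O a -> v a <= 1) \/ exists2 T, O T & 1 < v T.
Proof.
have [|h] := pselect (exists2 T, O T & 1 < v T); [by right|left => a Oa].
by rewrite leNgt; apply/negP => a1; apply: h; exists a.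
Qed.

(** The rank is thus controlled by the number of points in balls, and a bound on
    this number passes to limits of lattices. *)
Lemma count_bound (s : R) r : 0 < s -> exists K : R -> nat,
  (forall L, submodule L -> discrete L -> rank_le L r ->
    (forall l, L l -> l != 0 -> s <= v l) ->
    forall rho, (#|` ball_points L rho| <= K rho)%N) /\
  (forall L, submodule L -> discrete L ->
    (forall rho, #|` ball_points L rho| <= K rho)%N -> rank_le L r).
Proof.
move=> s0; have [fO|[T OT vT]] := ring_bounded_or; last exact: count_bound_infinite vT _ _ s0.
have [K [K1 K2]] := count_bound_finite fO r.
by exists (fun=> K); split => [L mL dL rL _|]; [exact: K1|exact: K2].
Qed.

Lemma discrete_finitely_generated L r : submodule L -> discrete L ->
  rank_le L r -> exists n (g : 'I_n -> C), L = O_span g.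
Proof.
have [fO|[T OT vT]] := ring_bounded_or.
  by move=> mL _ /(free_basis_finite fO mL)[s [b [_ ->]]]; exists s, b.
exact: discrete_finitely_generated_infinite OT vT L r.
Qed.

End Modules.

(** * Gauss norms of polynomials *)

Section GaussNorm.
Variables (R : realType) (C : fieldType) (v : absval R C).

(** A bound [g] on the Gauss norm of radius [rho]. *)
Definition gauss_le (rho g : R) (p : {poly C}) := forall j, v p`_j * rho ^+ j <= g.

Lemma gauss_le_ge0 rho g p : 0 < rho -> gauss_le rho g p -> 0 <= g.
Proof. by move=> r0 /(_ 0%N); apply: le_trans; rewrite mulr_ge0 ?abs_ge0 ?exprn_ge0// ltW. Qed.

Lemma gauss_leM rho g h p q : 0 < rho ->
  gauss_le rho g p -> gauss_le rho h q -> gauss_le rho (g * h) (p * q).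
Proof.
move=> r0 pg qh j; have g0 := gauss_le_ge0 r0 pg; have h0 := gauss_le_ge0 r0 qh.
rewrite -ler_pdivlMr ?exprn_gt0// coefM; apply: abs_sum_le => [|k _].
  by rewrite mulr_ge0 ?invr_ge0 ?exprn_ge0 ?mulr_ge0// ltW.
rewrite ler_pdivlMr ?exprn_gt0// absM -[in rho ^+ j](subnKC (leq_ord k)) exprD mulrACA.
by apply: ler_pM => //; rewrite mulr_ge0 ?abs_ge0 ?exprn_ge0// ltW.
Qed.

Lemma gauss_le1 rho : 0 < rho -> gauss_le rho 1 1.
Proof.
move=> r0 j; rewrite coef1; case: eqP => [->|_]; first by rewrite abs1 mulr1.
by rewrite abs0 mul0r.
Qed.

Lemma gauss_le_prod (I : Type) (s : seq I) (g : I -> R) (p : I -> {poly C}) rho :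
  0 < rho -> (forall k, gauss_le rho (g k) (p k)) ->
  gauss_le rho (\prod_(k <- s) g k) (\prod_(k <- s) p k).
Proof.
move=> r0 gp; elim/big_rec2: _ => [|k P G _ IH]; first exact: gauss_le1.
exact: gauss_leM.
Qed.

Lemma gauss_leX rho : 0 < rho -> gauss_le rho rho 'X.
Proof.
move=> r0 j; rewrite coefX; case: eqP => [->|_]; first by rewrite abs1 mul1r.
by rewrite abs0 mul0r ltW.
Qed.

Lemma gauss_le_factor rho l : 0 < rho ->
  gauss_le rho (Num.max 1 (rho / v l)) (1 - l^-1%:P * 'X).
Proof.
move=> r0 j; rewrite coefB coef1 coefCM coefX.
case: j => [|[|j]] /=.
- by rewrite mulr0 subr0 abs1 mulr1 le_max lexx.
- by rewrite mulr1 sub0r absN absV expr1 mulrC le_max lexx orbT.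
- by rewrite mulr0 subr0 abs0 mul0r le_max ler01.
Qed.

Lemma gauss_le_horner rho g p z : 0 < rho -> gauss_le rho g p -> v z <= rho ->
  v p.[z] <= g.
Proof.
move=> r0 pg zr; rewrite horner_coef; apply: abs_sum_le => [|k _].
  exact: gauss_le_ge0 pg.
apply: le_trans (pg k); rewrite absM absX ler_wpM2l ?abs_ge0//.
by rewrite lerXn2r ?nnegrE ?abs_ge0// ltW.
Qed.

(** Newton interpolation: no denominators occur at points of mutual distance 1. *)
Lemma gauss_le_interpolation (s : seq C) (p : {poly C}) S : 0 <= S ->
  (size p <= size s)%N -> pairwise (fun x y => v (x - y) == 1) s ->
  (forall x, x \in s -> v x <= 1) -> (forall x, x \in s -> v p.[x] <= S) ->
  gauss_le 1 S p.
Proof.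
move=> S0; elim: s => [|t s IH] in p *.
  by rewrite leqn0 size_poly_eq0 => /eqP-> _ _ _ j; rewrite coef0 abs0 mul0r.
move=> ps /= /andP[/allP ts pws] s1 pS.
have pt : v p.[t] <= S by apply: pS; rewrite mem_head.
have /factor_theorem[q qE] : root (p - p.[t]%:P) t by rewrite /root !hornerE subrr.
have pE : p = p.[t]%:P + q * ('X - t%:P) by rewrite -qE addrC subrK.
have qs : (size q <= size s)%N.
  have [->|q0] := eqVneq q 0; first by rewrite size_poly0.
  have -> : size q = (size (q * ('X - t%:P))).-1.
    by rewrite size_Mmonic ?monicXsubC// size_XsubC addn2.
  rewrite -qE -ltnS prednK ?size_poly_gt0 ?qE ?mulf_neq0 ?polyXsubC_eq0// -qE.
  apply: (leq_trans (size_polyD _ _)); rewrite geq_max ps size_polyN.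
  by rewrite (leq_trans (size_polyC_leq1 _)).
have qS x : x \in s -> v q.[x] <= S.
  move=> xs; have /ts/eqP tx := xs.
  have -> : v q.[x] = v (p.[x] - p.[t]).
    by rewrite {1}pE !hornerE addrAC subrr add0r absM -(abs_distC v t) tx mulr1.
  by apply: absB_le => //; apply: pS; rewrite inE xs orbT.
have {}IH := IH q qs pws (fun x xs => s1 x (mem_behead (s := t :: s) xs)) qS.
have t1 : v t <= 1 by apply: s1; rewrite mem_head.
move=> j; rewrite expr1n mulr1 pE coefD coefC mulrBr coefB coefMX coefMC.
have qj k : v q`_k <= S by have := IH k; rewrite expr1n mulr1.
apply: absD_le; first by case: ifP => _ //; rewrite abs0.
apply: absB_le; first by case: ifP => _ //; rewrite abs0.
by rewrite absM -[S]mulr1 ler_pM// ?abs_ge0.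
Qed.

Hypothesis sphere_point : forall (c : C) (s : seq C), c != 0 ->
  (forall x, x \in s -> v x <= v c) ->
  exists x, v x <= v c /\ forall y, y \in s -> v (x - y) = v c.

Lemma unit_distance_points n : exists s : seq C, [/\ size s = n,
  pairwise (fun x y => v (x - y) == 1) s & forall x, x \in s -> v x <= 1].
Proof.
elim: n => [|n [s [ss ps s1]]]; first by exists [::].
have := @sphere_point 1 s (oner_neq0 _); rewrite abs1 => /(_ s1)[x [x1 xs]].
exists (x :: s); split; first by rewrite /= ss.
  by rewrite /= ps andbT; apply/allP => y /xs->.
by move=> y; rewrite inE => /predU1P[->|/s1].
Qed.

(** The Gauss norm of radius 1 is the supremum norm on the unit ball, the residue
    field being infinite. *)
Lemma gauss_le_sup (p : {poly C}) S : 0 <= S ->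
  (forall z, v z <= 1 -> v p.[z] <= S) -> gauss_le 1 S p.
Proof.
move=> S0 pS; have [s [ss ps s1]] := unit_distance_points (size p).
exact: gauss_le_interpolation S0 (eq_leq (esym ss)) ps s1 (fun x xs => pS x (s1 x xs)).
Qed.

End GaussNorm.

Lemma prod_max_eq (R : realFieldType) (T : eqType) (s : seq T) (f : T -> R) c : 0 < c ->
  (forall x, x \in s -> 0 <= f x <= c) -> \prod_(x <- s) f x = c ^+ size s ->
  forall x, x \in s -> f x = c.
Proof.
move=> c0; elim: s => // y s IH fc; rewrite big_cons /= exprS => E.
have /andP[y0 yc] := fc y (mem_head _ _).
have fs x : x \in s -> 0 <= f x <= c by move=> xs; apply: fc; rewrite inE xs orbT.
have sc : \prod_(x <- s) f x <= c ^+ size s.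
  rewrite (_ : c ^+ _ = \prod_(x <- s) c).
    by rewrite big_seq [leRHS]big_seq; apply: ler_prod.
  by rewrite big_const_seq count_predT iter_mulr_1.
have fy : f y = c.
  apply/le_anti; rewrite yc leNgt; apply/negP => ltyc; move/eqP: E.
  rewrite lt_eqF//; apply: (@le_lt_trans _ _ (f y * c ^+ size s)).
    exact: ler_wpM2l.
  by rewrite ltr_pM2r ?exprn_gt0.
move=> x; rewrite inE => /predU1P[->//|]; apply: IH => //.
by apply: (@mulfI _ c); rewrite ?gt_eqF// -E fy.
Qed.

(** Over an algebraically closed field, a root of the polynomial
    [\prod_i ('X - m i) - c ^+ k] works; the general case follows by density. *)
Lemma dense_closed_sphere_point (R : realType) (K : closedFieldType) (C : fieldType)
  (w : absval R K) (v : absval R C) (j : {rmorphism K -> C}) :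
  (forall x, v (j x) = w x) -> dense (range j : set (vtop v)) ->
  forall (c : C) (s : seq C), c != 0 -> (forall x, x \in s -> v x <= v c) ->
  exists x, v x <= v c /\ forall y, y \in s -> v (x - y) = v c.
Proof.
move=> vj dj c s c0 sc; have vc0 : 0 < v c by rewrite abs_gt0.
have app (z : C) : exists x, v (z - j x) < v c.
  have [] := dj (ball (z : vtop v) (v c))°%classic.
  - by exists z; apply: nbhsx_ballx.
  - exact: open_interior.
  - by move=> y [/interior_subset zy [x _ xy]]; exists x; rewrite xy.
have {app}/(_ _)/cid-/all_sig[a aP] := app.
have wc : w (a c) = v c.
  by rewrite -vj -(subKr c (j _)) (absB_lt (aP c)).
pose m := a 0 :: map a s.
have wm x : x \in m -> w x <= v c.
  have wa z : v z <= v c -> w (a z) <= v c.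
    by move=> zc; rewrite -vj -(subKr z (j _)); apply: absB_le => //; exact: ltW.
  rewrite inE => /predU1P[->|/mapP[z /sc zc ->]]; last exact: wa.
  by apply: wa; rewrite abs0 ltW.
pose p := \prod_(x <- m) ('X - x%:P) - (a c ^+ size m)%:P.
have sp : size p = (size m).+1.
  by rewrite size_polyDl ?size_prod_XsubC// size_polyN (leq_ltn_trans (size_polyC_leq1 _)).
have /closed_rootP[x] : size p != 1 by rewrite sp.
rewrite /root /p hornerD hornerN hornerC horner_prod subr_eq0.
under eq_bigr do rewrite hornerXsubC.
move=> /eqP/(congr1 w).
rewrite abs_prod absX wc => prodE.
have xc : w x <= v c.
  rewrite leNgt; apply/negP => cx; move/eqP: prodE; apply/negP.
  rewrite gt_eqF// (eq_big_seq (fun=> w x)) => [|y ym]; last first.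
    by rewrite absB_lt// (le_lt_trans (wm y ym)).
  rewrite big_const_seq count_predT iter_mulr_1.
  by rewrite ltrXn2r// ?nnegrE ?abs_ge0 ?ltW.
have xm y : y \in m -> w (x - y) = v c.
  apply: (prod_max_eq (f := fun y => w (x - y)) vc0 _ prodE) => z zm.
  by rewrite abs_ge0; apply: absB_le => //; exact: wm.
exists (j x); split; first by rewrite vj.
move=> y ys; have -> : j x - y = j (x - a y) - (y - j (a y)) by rewrite rmorphB; ring.
have ay : w (x - a y) = v c by apply: xm; rewrite inE map_f ?orbT.
by rewrite absB_lt vj ay.
Qed.

(** * Exponentials of lattices *)

Lemma complete_limit (R : realType) (C : fieldType) (v : absval R C)
    (G : set_system (vtop v)) : cauchy_complete (vtop v) -> ProperFilter G ->
  (forall e, 0 < e -> exists x : C, G [set y | v (x - (y : C)) < e]) ->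
  forall e, 0 < e -> G [set y | v ((lim G : C) - (y : C)) < e].
Proof.
move=> cC PG cG; have /cC GG : cauchy G by apply/cauchyP => e /cG.
by move=> e e0; move/cvg_ballP : GG => /(_ e e0).
Qed.

Section Exponential.
Variables (R : realType) (C : fieldType) (v : absval R C) (O : set C).
Hypothesis complete_C : cauchy_complete (vtop v).

Definition nonzero_points (L : set C) (N : R) : {fset C} :=
  fset_set (L `&` [set l | l != 0 /\ v l <= N]).

Definition partial_exp (L : set C) (N : R) (z : C) : C :=
  z * \prod_(l <- nonzero_points L N) (1 - z / l).

Definition partial_exp_poly (L : set C) (N : R) : {poly C} :=
  'X * \prod_(l <- nonzero_points L N) (1 - l^-1%:P * 'X).

Lemma horner_partial_exp L N z : (partial_exp_poly L N).[z] = partial_exp L N z.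
Proof.
rewrite hornerM hornerX horner_prod; congr (_ * _); apply: eq_bigr => l _.
by rewrite !hornerE mulrC.
Qed.

Lemma nonzero_finite L N : discrete v L ->
  finite_set (L `&` [set l | l != 0 /\ v l <= N]).
Proof. by move=> /(_ N); apply: sub_finite_set => z [? []]. Qed.

Lemma nonzero_pointsP L N z : discrete v L ->
  reflect [/\ L z, z != 0 & v z <= N] (z \in nonzero_points L N).
Proof.
move=> dL; rewrite in_fset_set; last exact: nonzero_finite.
by apply: (iffP idP) => [/set_mem[? []]|[? ? ?]] //; apply/mem_set.
Qed.

Lemma lattice_expE L z : discrete v L -> lattice_exp v L z =
  lim ((fun N : nat => partial_exp L N%:R z : vtop v) @ \oo).
Proof.
move=> dL; rewrite /lattice_exp; congr (lim (_ @ \oo)); apply/funext => N.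
by rewrite fsbig_finite//; exact: nonzero_finite.
Qed.

Lemma prod_near_1 (s : seq C) z rho M : 0 < M -> v z <= rho -> rho <= M ->
  (forall l, l \in s -> M <= v l) ->
  v (\prod_(l <- s) (1 - z / l) - 1) <= rho / M.
Proof.
move=> M0 zr rM; have r0 : 0 <= rho := le_trans (abs_ge0 v z) zr.
have rM1 : rho / M <= 1 by rewrite ler_pdivrMr ?mul1r.
elim: s => [|l s IH] sM; first by rewrite big_nil subrr abs0 divr_ge0// ltW.
have {}IH : v (\prod_(l <- s) (1 - z / l) - 1) <= rho / M.
  by apply: IH => k ks; apply: sM; rewrite inE ks orbT.
rewrite big_cons; set Q := \prod_(_ <- _) _ in IH *.
have -> : (1 - z / l) * Q - 1 = Q - 1 - z / l * Q by ring.
apply: absB_le => //; rewrite absM -[leRHS]mulr1 ler_pM ?abs_ge0//.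
  have Ml := sM l (mem_head _ _); rewrite absM absV.
  by rewrite ler_pM ?abs_ge0 ?invr_ge0 ?abs_ge0// lef_pV2// posrE (lt_le_trans M0).
by rewrite -(subrK 1 Q); apply: absD_le; rewrite ?abs1// (le_trans IH).
Qed.

Lemma prod_fsubset_close (S S' : {fset C}) z rho M : (S `<=` S')%fset ->
  0 < M -> v z <= rho -> rho <= M ->
  (forall l, l \in S' -> l \notin S -> M <= v l) ->
  v (\prod_(l <- S') (1 - z / l) - \prod_(l <- S) (1 - z / l)) <=
    v (\prod_(l <- S) (1 - z / l)) * (rho / M).
Proof.
move=> SS' M0 zr rM far.
have -> : \prod_(l <- S') (1 - z / l) =
    \prod_(l <- S) (1 - z / l) * \prod_(l <- (S' `\` S)%fset) (1 - z / l).
  rewrite -big_cat; apply: perm_big; apply: uniq_perm.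
  - exact: fset_uniq.
  - rewrite cat_uniq !fset_uniq andbT/=; apply/hasPn => l.
    by rewrite in_fsetD => /andP[].
  - move=> l; rewrite mem_cat in_fsetD.
    by have [lS|//] := boolP (l \in S); rewrite (fsubsetP SS').
rewrite -[X in _ - X]mulr1 -mulrBr absM ler_wpM2l ?abs_ge0//.
by apply: prod_near_1 => // l; rewrite in_fsetD => /andP[lS lS']; exact: far.
Qed.

Section Bounded.
Variables (s : R) (K : R -> nat).
Hypothesis s0 : 0 < s.

(** The estimates below are uniform in the lattices with given [s] and [K]. *)
Record tame (L : set C) : Prop := Tame {
  tame_mod : submodule O L;
  tame_discrete : discrete v L;
  tame_min : forall l, L l -> l != 0 -> s <= v l;
  tame_card : forall rho, (#|` ball_points v L rho| <= K rho)%N }.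

(** Bounds the Gauss norm of radius [rho] of the exponential. *)
Definition exp_bound (rho : R) : R := rho * Num.max 1 (rho / s) ^+ K rho.

Lemma exp_bound_ge0 rho : 0 < rho -> 0 <= exp_bound rho.
Proof. by move=> r0; rewrite mulr_ge0 ?exprn_ge0 ?le_max ?ler01// ltW. Qed.

(** Only the elements of absolute value at most [rho] contribute to the Gauss
    norm of radius [rho]. *)
Lemma gauss_le_partial_exp L N rho : tame L -> 0 < rho ->
  gauss_le v rho (exp_bound rho) (partial_exp_poly L N).
Proof.
move=> tL r0; have dL := tame_discrete tL.
pose S := nonzero_points L N; set B := Num.max 1 (rho / s).
have B1 : 1 <= B by rewrite le_max lexx.
have prodB : \prod_(l <- S) Num.max 1 (rho / v l) <= B ^+ K rho.
  apply: (@le_trans _ _ (\prod_(l <- S) (if v l <= rho then B else 1))).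
    rewrite big_seq [leRHS]big_seq; apply: ler_prod => l.
    case/(nonzero_pointsP _ _ dL) => Ll l0 _; have sl := tame_min tL Ll l0.
    have vl0 : 0 < v l by rewrite abs_gt0.
    rewrite le_max ler01/=; case: (leP (v l) rho) => lr.
      rewrite ge_max B1 le_max; apply/orP; right.
      by apply: ler_wpM2l; rewrite ?lef_pV2// ltW.
    by rewrite ge_max lexx ler_pdivrMr// mul1r ltW.
  rewrite -big_mkcond big_const_seq iter_mulr_1 ler_weXn2l//.
  apply: leq_trans (tame_card tL rho); rewrite -size_filter.
  apply: card_ball_points_ge; [by []|by rewrite filter_uniq// fset_uniq|].
  by move=> l; rewrite mem_filter => /andP[lr /(nonzero_pointsP _ _ dL)[]].
have h := gauss_leM r0 (gauss_leX v r0)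
  (gauss_le_prod S r0 (fun l => gauss_le_factor v l r0)).
by move=> j; apply: le_trans (h j) _; rewrite ler_wpM2l// ltW.
Qed.

Lemma partial_exp_le L N rho z : tame L -> 0 < rho -> v z <= rho ->
  v (partial_exp L N z) <= exp_bound rho.
Proof.
move=> tL r0 zr; rewrite -horner_partial_exp.
exact: gauss_le_horner r0 (gauss_le_partial_exp _ tL r0) zr.
Qed.

Lemma partial_exp_close L N N' rho z : tame L -> 0 < rho -> v z <= rho ->
  rho <= N -> N <= N' ->
  v (partial_exp L N' z - partial_exp L N z) <= exp_bound rho * (rho / N).
Proof.
move=> tL r0 zr rN NN'; have dL := tame_discrete tL.
have N0 : 0 < N := lt_le_trans r0 rN.
rewrite /partial_exp -mulrBr absM.
apply: (@le_trans _ _ (v z * (v (\prod_(l <- nonzero_points L N) (1 - z / l)) * (rho / N)))).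
  rewrite ler_wpM2l ?abs_ge0//; apply: prod_fsubset_close => //.
    apply/fsubsetP => l /(nonzero_pointsP _ _ dL)[Ll l0 lN].
    by apply/(nonzero_pointsP _ _ dL); split => //; exact: le_trans NN'.
  move=> l /(nonzero_pointsP _ _ dL)[Ll l0 _] lN.
  by rewrite leNgt; apply: contra lN => lN; apply/(nonzero_pointsP _ _ dL); rewrite ltW.
rewrite mulrA -absM; apply: ler_wpM2r; first by rewrite divr_ge0// ltW.
exact: partial_exp_le.
Qed.

Lemma exp_close L (N : nat) rho z : tame L -> 0 < rho -> v z <= rho ->
  rho <= N%:R ->
  v ((lattice_exp v L z : C) - partial_exp L N%:R z) <= exp_bound rho * (rho / N%:R).
Proof.
move=> tL r0 zr rN; have N0 : 0 < N%:R :> R := lt_le_trans r0 rN.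
have B0 := exp_bound_ge0 r0.
rewrite lattice_expE; last exact: tame_discrete.
pose u (M : nat) : vtop v := partial_exp L M%:R z.
have u_close (M M' : nat) : (N <= M)%N -> (M <= M')%N ->
    v ((u M : C) - u M') <= exp_bound rho * (rho / M%:R).
  move=> NM MM'; rewrite abs_distC; apply: partial_exp_close; rewrite ?ler_nat//.
  by rewrite (le_trans rN)// ler_nat.
have u_lim := @complete_limit R C v (u @ \oo) complete_C _ _.
have {}u_lim e : 0 < e -> \forall M \near \oo, v ((lim (u @ \oo) : C) - u M) < e.
  apply: u_lim => {}e e0.
  pose M0 := (N + Num.bound (exp_bound rho * rho / e))%N.
  exists (u M0); exists M0 => // M /= M0M.
  apply: le_lt_trans (u_close _ _ _ M0M) _; first exact: leq_addr.
  have M00 : 0 < M0%:R :> R by rewrite (lt_le_trans N0)// ler_nat leq_addr.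
  rewrite mulrA ltr_pdivrMr// [ltRHS]mulrC -ltr_pdivrMr// natrD ltr_wpDl//.
  by apply/archi_boundP/divr_ge0; [apply: mulr_ge0 => //|]; exact: ltW.
apply/ler_addgt0Pl => e e0.
have [M [NM uM]] : exists M, (N <= M)%N /\ v ((lim (u @ \oo) : C) - u M) < e.
  have [M0 _ M0P] := u_lim e e0; exists (N + M0)%N; split; first exact: leq_addr.
  by apply: M0P => /=; exact: leq_addl.
apply: (le_trans (abs_triangle v (u M) _ _)); apply: lerD; first exact: ltW.
by rewrite abs_distC; exact: u_close.
Qed.

Lemma large_nat (a : R) : exists N : nat, (0 < N)%N /\ a <= N%:R.
Proof.
exists (Num.bound a).+1; split => //.
by rewrite (le_trans (ler_norm a))// ltW// (lt_trans (archi_boundP (normr_ge0 a)))// ltr_nat /Num.bound normr_id.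
Qed.

Lemma large_nat_div (a e : R) : 0 < e -> exists N0 : nat, forall N : nat,
  (N0 <= N)%N -> a / N%:R <= e.
Proof.
move=> e0; have [N0 [N00 N0P]] := large_nat (a / e); exists N0 => N N0N.
have N1 : 0 < N%:R :> R by rewrite ltr0n (leq_trans N00).
by rewrite ler_pdivrMr// mulrC -ler_pdivrMr// (le_trans N0P)// ler_nat.
Qed.

(** The factors left out are close to 1, and the others are bounded by [exp_bound]. *)
Lemma exp_approx_uniform rho e : 0 < rho -> 0 < e -> exists N0 : nat,
  forall N : nat, (N0 <= N)%N -> rho <= N%:R /\ forall L z, tame L -> v z <= rho ->
    v ((lattice_exp v L z : C) - partial_exp L N%:R z) <= e.
Proof.
move=> r0 e0; have [N0 [_ N0P]] := large_nat rho.
have [N1 N1P] := large_nat_div (exp_bound rho * rho) e0.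
exists (maxn N0 N1) => N; rewrite geq_max => /andP[NN0 /N1P NN1].
have rN : rho <= N%:R by rewrite (le_trans N0P)// ler_nat.
split => // L z tL zr; apply: le_trans NN1; rewrite -mulrA; exact: exp_close.
Qed.

Lemma exp_approx L rho e : tame L -> 0 < rho -> 0 < e -> exists N0 : nat,
  forall N : nat, (N0 <= N)%N -> rho <= N%:R /\ forall z, v z <= rho ->
    v ((lattice_exp v L z : C) - partial_exp L N%:R z) <= e.
Proof.
move=> tL r0 e0; have [N0 N0P] := exp_approx_uniform r0 e0.
by exists N0 => N /N0P[rN NP]; split => // z; exact: NP.
Qed.

Lemma gauss_leB rho g (p q : {poly C}) : 0 < rho ->
  gauss_le v rho g p -> gauss_le v rho g q -> gauss_le v rho g (p - q).
Proof.
move=> r0 pg qg j; rewrite -ler_pdivlMr ?exprn_gt0// coefB.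
by apply: absB_le; rewrite ler_pdivlMr ?exprn_gt0.
Qed.

Section SpherePoints.
Hypothesis sphere_point : forall (c : C) (r : seq C), c != 0 ->
  (forall x, x \in r -> v x <= v c) ->
  exists x, v x <= v c /\ forall y, y \in r -> v (x - y) = v c.

(** Closeness on the unit ball propagates to all balls: it bounds the first [J]
    coefficients of the difference, and the others are uniformly small. *)
Lemma exp_close_propagates L1 L2 e rho J : tame L1 -> tame L2 -> 0 < e -> 1 <= rho ->
  (forall z, v z <= 1 -> v ((lattice_exp v L1 z : C) - lattice_exp v L2 z) <= e) ->
  forall z, v z <= rho -> v ((lattice_exp v L1 z : C) - lattice_exp v L2 z) <=
    Num.max (e * rho ^+ J) (exp_bound (2 * rho) / 2 ^+ J).
Proof.
move=> t1 t2 e0 r1 ee z zr; have r0 : 0 < rho by exact: lt_le_trans r1.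
set m := Num.max _ _.
have m0 : 0 < m by rewrite lt_max mulr_gt0 ?exprn_gt0.
have [N1 N1P] := exp_approx t1 ltr01 e0; have [N2 N2P] := exp_approx t2 ltr01 e0.
have [M1 M1P] := exp_approx t1 r0 m0; have [M2 M2P] := exp_approx t2 r0 m0.
pose N := maxn (maxn N1 N2) (maxn M1 M2).
have [_ {}N1P] := N1P N (leq_trans (leq_maxl _ _) (leq_maxl _ _)).
have [_ {}N2P] := N2P N (leq_trans (leq_maxr _ _) (leq_maxl _ _)).
have [_ {}M1P] := M1P N (leq_trans (leq_maxl _ _) (leq_maxr _ _)).
have [_ {}M2P] := M2P N (leq_trans (leq_maxr _ _) (leq_maxr _ _)).
pose P := partial_exp_poly L1 N%:R - partial_exp_poly L2 N%:R.
have Pe j : v P`_j <= e.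
  have := @gauss_le_sup R C v sphere_point P e (ltW e0) _ j.
  rewrite expr1n mulr1; apply => w w1; rewrite hornerD hornerN !horner_partial_exp.
  apply: (abs_dist_le (y := lattice_exp v L1 w)).
    by rewrite abs_distC; exact: N1P.
  by apply: (abs_dist_le (y := lattice_exp v L2 w)); [exact: ee|exact: N2P].
have r2 : 0 < 2 * rho by rewrite mulr_gt0.
have Pg := gauss_leB r2 (gauss_le_partial_exp N%:R t1 r2) (gauss_le_partial_exp N%:R t2 r2).
have Pz : v P.[z] <= m.
  rewrite horner_coef; apply: abs_sum_le => [|j _]; first exact: ltW.
  apply: (@le_trans _ _ (v P`_j * rho ^+ j)).
    by rewrite absM absX ler_wpM2l ?abs_ge0// lerXn2r ?nnegrE ?abs_ge0// ltW.
  rewrite le_max; case: (leqP j J) => jJ; apply/orP; [left|right].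
    by rewrite ler_pM ?abs_ge0 ?exprn_ge0 ?ler_weXn2l// ltW.
  rewrite ler_pdivlMr ?exprn_gt0//; apply: le_trans (Pg j).
  rewrite exprMn -mulrA; apply: ler_wpM2l; first exact: abs_ge0.
  rewrite mulrC; apply: ler_wpM2r; first by rewrite exprn_ge0// ltW.
  by apply: ler_weXn2l; [rewrite ler1n|exact: ltnW].
move: Pz; rewrite hornerD hornerN !horner_partial_exp => Pz.
apply: (abs_dist_le (y := partial_exp L1 N%:R z)); first exact: M1P.
by apply: (abs_dist_le Pz); rewrite abs_distC; exact: M2P.
Qed.

End SpherePoints.

Lemma seq_argmin (T : eqType) (f : T -> R) (x : T) (r : seq T) : x \in r ->
  exists2 y, y \in r & forall t, t \in r -> f y <= f t.
Proof.
elim: r x => // a [|b r] IH x _.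
  by exists a; rewrite ?mem_head// => t; rewrite inE => /eqP->.
have [y ys yP] := IH b (mem_head _ _).
have [ay|ya] := leP (f a) (f y).
  exists a; first exact: mem_head.
  by move=> t; rewrite inE => /predU1P[->//|/yP]; exact: le_trans.
exists y; first by rewrite inE ys orbT.
by move=> t; rewrite inE => /predU1P[->|/yP//]; exact: ltW.
Qed.

(** The product of the [v (z - m)] over the points of a ball does not change when
    [z] is translated by one of them; translate by the nearest one. *)
Lemma partial_exp_ge_dist L N z : tame L -> 0 <= N ->
  exists2 m, L m & v (z - m) <= v (partial_exp L N z).
Proof.
move=> tL N0; have dL := tame_discrete tL; have mL := tame_mod tL.
set W := ball_points v L N; set Z := nonzero_points L N.
have W0 : 0 \in W by apply/(ball_pointsP _ _ dL); rewrite abs0; split => //; exact: sm0 mL.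
have [m mW mP] := seq_argmin (fun m => v (z - m)) W0.
have [Lm mN] := elimT (ball_pointsP _ _ dL) mW.
exists m => //; pose D y := \prod_(l <- W) v (y - l).
have Wperm : perm_eq W (0 :: Z).
  apply: uniq_perm; first exact: fset_uniq.
    rewrite /= fset_uniq andbT; apply/negP => /(nonzero_pointsP _ _ dL)[_].
    by rewrite eqxx.
  move=> l; rewrite inE; apply/(ball_pointsP _ _ dL)/predU1P => [[Ll lN]|].
    have [->|l0] := eqVneq l 0; [by left|right].
    by apply/(nonzero_pointsP _ _ dL).
  by move=> [->|/(nonzero_pointsP _ _ dL)[]//]; apply/(ball_pointsP _ _ dL).
have DE y : D y = v y * \prod_(l <- Z) v (y - l).
  by rewrite /D (perm_big _ Wperm) big_cons subr0.
have Z0 : 0 < \prod_(l <- Z) v l.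
  rewrite big_seq prodr_gt0// => l /(nonzero_pointsP _ _ dL)[_ l0 _].
  by rewrite abs_gt0.
have DzE : v (partial_exp L N z) * \prod_(l <- Z) v l = D z.
  rewrite DE absM abs_prod -mulrA -big_split/=; congr (_ * _).
  rewrite big_seq [RHS]big_seq; apply: eq_bigr => l /(nonzero_pointsP _ _ dL)[_ l0 _].
  by rewrite -absM mulrBl mul1r mulfVK// abs_distC.
have Dm : D z = D (z - m).
  rewrite /D (perm_big [seq m + l | l <- W]); last first.
    apply: uniq_perm; [exact: fset_uniq|by rewrite map_inj_uniq ?fset_uniq//; exact: addrI|].
    move=> l; apply/idP/mapP => [/(ball_pointsP _ _ dL)[Ll lN]|[k + ->]].
      exists (l - m); last by rewrite subrKC.
      by apply/(ball_pointsP _ _ dL); split; [exact: smB mL _ _ Ll Lm|exact: absB_le].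
    move=> /(ball_pointsP _ _ dL)[Lk kN].
    by apply/(ball_pointsP _ _ dL); split; [exact: smD mL Lm Lk|exact: absD_le].
  by rewrite big_map; apply: eq_bigr => l _; rewrite opprD addrA.
rewrite -(ler_pM2r Z0) DzE Dm DE ler_wpM2l ?abs_ge0//.
rewrite big_seq [leRHS]big_seq; apply: ler_prod => l /(nonzero_pointsP _ _ dL)[Ll l0 lN].
rewrite abs_ge0/=; have zml : v (z - m) <= v (z - m - l).
  rewrite -addrA -opprD; apply: mP; apply/(ball_pointsP _ _ dL).
  by split; [exact: smD mL Lm Ll|exact: absD_le].
have [lz|zl] := leP (v l) (v (z - m)); first exact: le_trans zml.
by rewrite (abs_distC v (z - m)) absB_lt.
Qed.

Lemma exp_ge_dist L z e : tame L -> 0 < e -> v (lattice_exp v L z : C) <= e ->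
  exists2 m, L m & v (z - m) <= e.
Proof.
move=> tL e0 ze; have r0 : 0 < v z + 1 by rewrite ltr_wpDl ?abs_ge0.
have [N /(_ N (leqnn _))[_ NP]] := exp_approx tL r0 e0.
have [m Lm mz] := @partial_exp_ge_dist L N%:R z tL (ler0n _ _).
exists m => //; apply: le_trans mz _.
rewrite -[partial_exp _ _ _](subKr (lattice_exp v L z : C)).
by apply: absB_le => //; apply: NP; rewrite lerDl.
Qed.

Lemma exp_zero L l e : tame L -> L l -> 0 < e -> v (lattice_exp v L l : C) <= e.
Proof.
move=> tL Ll e0; have r0 : 0 < v l + 1 by rewrite ltr_wpDl ?abs_ge0.
have [N /(_ N (leqnn _))[rN NP]] := exp_approx tL r0 e0.
have dL := tame_discrete tL.
have p0 : partial_exp L N%:R l = 0.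
  have [->|l0] := eqVneq l 0; first by rewrite /partial_exp mul0r.
  have lN : l \in nonzero_points L N%:R.
    by apply/(nonzero_pointsP _ _ dL); split => //; rewrite (le_trans _ rN)// lerDl.
  by rewrite /partial_exp (big_rem l lN)/= divff// subrr mul0r mulr0.
by have := NP l; rewrite p0 subr0; apply; rewrite lerDl.
Qed.

Lemma exp_le L z : tame L -> v z <= 1 ->
  v (lattice_exp v L z : C) <= Num.max 1 (exp_bound 1).
Proof.
move=> tL z1; have [N /(_ N (leqnn _))[_ NP]] := exp_approx tL ltr01 ltr01.
rewrite -[lattice_exp v L z : C](subrK (partial_exp L N%:R z)).
by apply: absD_le; rewrite le_max ?NP ?partial_exp_le ?orbT.
Qed.

End Bounded.

(** At a generic point [x] of the unit sphere, the exponential of [L] has absolute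
    value the product of the [1 / v l] over the [l] of absolute value below 1: a
    bound on the exponential keeps the lattice away from zero. *)
Lemma min_abs_of_exp_bound s K L B : 0 < s ->
  (forall (c : C) (s : seq C), c != 0 -> (forall x, x \in s -> v x <= v c) ->
    exists x, v x <= v c /\ forall y, y \in s -> v (x - y) = v c) ->
  tame s K L -> 1 <= B ->
  (forall z, v z <= 1 -> v (lattice_exp v L z : C) <= B) ->
  forall l, L l -> l != 0 -> B^-1 <= v l.
Proof.
move=> s0 sphere tL B1 eB l Ll l0; rewrite leNgt; apply/negP => lB.
have dL := tame_discrete tL; have B0 : 0 < B by exact: lt_le_trans B1.
have vl0 : 0 < v l by rewrite abs_gt0.
have Bl : B < (v l)^-1 by rewrite -[B]invrK ltf_pV2// posrE invr_gt0.
have l1 : v l <= 1 by rewrite (le_trans (ltW lB))// invf_le1.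
have [|x [_ +]] := sphere 1 (ball_points v L 1) (oner_neq0 _).
  by move=> y /(ball_pointsP _ _ dL)[_]; rewrite abs1.
rewrite abs1 => xP; have vx : v x = 1.
  rewrite -[x]subr0; apply/xP/(ball_pointsP _ _ dL); rewrite abs0 ler01.
  by split => //; exact: sm0 (tame_mod tL).
have [N /(_ N (leqnn _))[N1 NP]] := exp_approx s0 tL ltr01 B0.
have px : B < v (partial_exp L N%:R x).
  pose f k := v (1 - x / k).
  have fE k : k != 0 -> f k = v (x - k) / v k.
    by move=> k0; rewrite -absV -absM mulrBl divff// abs_distC.
  have f1 k : k \in nonzero_points L N%:R -> 1 <= f k.
    move=> /(nonzero_pointsP _ _ dL)[Lk k0 kN]; have vk0 : 0 < v k by rewrite abs_gt0.
    rewrite fE//; have [k1|k1] := leP (v k) 1.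
      by rewrite xP ?ler_pdivlMr ?mul1r//; apply/(ball_pointsP _ _ dL).
    by rewrite abs_distC absB_lt ?vx// divff// gt_eqF.
  have lN : l \in nonzero_points L N%:R.
    by apply/(nonzero_pointsP _ _ dL); split => //; exact: le_trans N1.
  rewrite absM vx mul1r abs_prod (big_rem l lN)/=.
  apply: (@lt_le_trans _ _ (f l)).
    by rewrite fE// xP ?mul1r//; apply/(ball_pointsP _ _ dL).
  rewrite ler_peMr ?abs_ge0// big_seq; elim/big_ind: _ => //.
    by move=> a b a1 b1; rewrite -[1]mulr1 ler_pM.
  by move=> k /mem_rem/f1.
have := eB x; rewrite vx => /(_ (lexx _)).
rewrite -[lattice_exp v L x : C](subrK (partial_exp L N%:R x)) addrC.
rewrite absD_lt; first by rewrite leNgt px.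
by apply: le_lt_trans (NP x _) px; rewrite vx.
Qed.

(** On the unit ball, the factor of an added element [l] differs from 1 by at most
    [1 / v l]. *)
Lemma exp_superlattice_close s K L s' K' L' M z : 0 < s -> 0 < s' ->
  tame s K L -> tame s' K' L' -> L `<=` L' -> 1 <= M ->
  (forall l, L' l -> ~ L l -> M <= v l) -> v z <= 1 ->
  v ((lattice_exp v L z : C) - lattice_exp v L' z) <= exp_bound s K 1 / M.
Proof.
move=> s0 s'0 tL tL' LL' M1 far z1; have M0 : 0 < M by exact: lt_le_trans M1.
have dL := tame_discrete tL; have dL' := tame_discrete tL'.
apply/ler_addgt0Pl => e e0.
have [N1 N1P] := exp_approx s0 tL ltr01 e0; have [N2 N2P] := exp_approx s'0 tL' ltr01 e0.
have [_ {}N1P] := N1P _ (leq_maxl N1 N2); have [_ {}N2P] := N2P _ (leq_maxr N1 N2).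
set N := (maxn N1 N2)%:R in N1P N2P.
have pp : v (partial_exp L N z - partial_exp L' N z) <= exp_bound s K 1 / M.
  rewrite abs_distC /partial_exp -mulrBr absM.
  apply: (@le_trans _ _ (v z * (v (\prod_(l <- nonzero_points L N) (1 - z / l)) * (1 / M)))).
    rewrite ler_wpM2l ?abs_ge0//; apply: prod_fsubset_close => //.
      apply/fsubsetP => l /(nonzero_pointsP _ _ dL)[Ll l0 lN].
      by apply/(nonzero_pointsP _ _ dL'); split => //; exact: LL'.
    move=> l /(nonzero_pointsP _ _ dL')[Ll l0 lN] lNL; apply: far => // L'l.
    by case/negP: lNL; apply/(nonzero_pointsP _ _ dL).
  rewrite mulrA -absM div1r; apply: ler_wpM2r; first by rewrite invr_ge0 ltW.
  exact: (@partial_exp_le s K s0 L N 1 z tL ltr01 z1).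
apply: (@le_trans _ _ (Num.max e (exp_bound s K 1 / M))).
  apply: (abs_dist_le (y := partial_exp L N z)).
    by rewrite le_max N1P.
  apply: (abs_dist_le (y := partial_exp L' N z)); first by rewrite le_max pp orbT.
  by rewrite abs_distC le_max N2P.
rewrite ge_max; apply/andP; split; last by rewrite lerDr ltW.
by rewrite lerDl; apply: divr_ge0; [exact: exp_bound_ge0|exact: ltW].
Qed.

End Exponential.

(** * Limits of Cauchy filters of lattices *)

Lemma positive_lower_bound (R : realType) (C : fieldType) (v : absval R C) (r : seq C) :
  exists2 s : R, 0 < s & forall x, x \in r -> x != 0 -> s <= v x.
Proof.
elim: r => [|x r [s s0 sP]]; first by exists 1.
have [->|x0] := eqVneq x 0.
  by exists s => // y; rewrite inE => /predU1P[->|/sP//]; rewrite eqxx.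
exists (Num.min s (v x)); first by rewrite lt_min s0 abs_gt0.
by move=> y; rewrite inE ge_min => /predU1P[->|/sP yr /yr->//]; rewrite lexx orbT.
Qed.

Lemma discrete_tame (R : realType) (C : fieldType) (v : absval R C) (O L : set C) :
  submodule O L -> discrete v L -> exists s K, 0 < s /\ tame v O s K L.
Proof.
move=> mL dL; have [s s0 sP] := positive_lower_bound v (ball_points v L 1).
exists (Num.min s 1), (fun rho => #|` ball_points v L rho|).
split; first by rewrite lt_min s0 ltr01.
split => // l Ll l0; rewrite ge_min; have [l1|/ltW->] := leP (v l) 1; last by rewrite orbT.
by rewrite sP//; apply/(ball_pointsP _ _ dL).
Qed.

Lemma prod_close (R : realType) (C : fieldType) (v : absval R C) (T : eqType)
    (r : seq T) (a b : T -> C) (e B : R) : 0 <= e -> 1 <= B ->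
  (forall x, x \in r -> [/\ v (a x) <= B, v (b x) <= B & v (a x - b x) <= e]) ->
  v (\prod_(x <- r) a x - \prod_(x <- r) b x) <= e * B ^+ size r.
Proof.
move=> e0 B1; have B0 : 0 <= B by exact: le_trans B1.
elim: r => [|x r IH] ab; first by rewrite !big_nil subrr abs0 expr0 mulr1.
have [ax bx abx] := ab x (mem_head _ _).
have abr y : y \in r -> [/\ v (a y) <= B, v (b y) <= B & v (a y - b y) <= e].
  by move=> yr; apply: ab; rewrite inE yr orbT.
rewrite !big_cons; set P := \prod_(_ <- _) a _; set Q := \prod_(_ <- _) b _.
have -> : a x * P - b x * Q = (a x - b x) * P + b x * (P - Q) by ring.
have Pr : v P <= B ^+ size r.
  rewrite abs_prod (_ : B ^+ _ = \prod_(y <- r) B); last by rewrite big_const_seq count_predT iter_mulr_1.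
  rewrite big_seq [leRHS]big_seq; apply: ler_prod => y /abr[ay _ _].
  by rewrite abs_ge0.
apply: absD_le; rewrite absM exprS.
  apply: ler_pM; rewrite ?abs_ge0//; apply: (le_trans Pr).
  by rewrite ler_peMl// exprn_ge0.
by rewrite mulrCA; apply: ler_pM; rewrite ?abs_ge0//; exact: IH.
Qed.

Section CauchyLattices.
Variables (R : realType) (C : fieldType) (v : absval R C) (O : set C).
Hypotheses (complete_C : cauchy_complete (vtop v)) (dO : discrete_ring v O).
Hypothesis sphere_point : forall (c : C) (r : seq C), c != 0 ->
  (forall x, x \in r -> v x <= v c) ->
  exists x, v x <= v c /\ forall y, y \in r -> v (x - y) = v c.
Variables (I : Type) (FF : set_system I) (PF : ProperFilter FF).
Variables (L : I -> set C) (r : nat).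
Hypotheses (mL : forall i, submodule O (L i)) (dL : forall i, discrete v (L i))
  (rL : forall i, rank_le O (L i) r).
Let E (S : set C) (z : C) : C := lattice_exp v S z.
Hypothesis cauchy_L : forall e, 0 < e -> exists i0, FF [set i | forall z, v z <= 1 ->
  v (E (L i0) z - E (L i) z) <= e].

(** The exponentials are eventually bounded on the unit ball by a common [B], so
    nonzero elements are at least [1 / B] in absolute value; with the bound on the
    ranks, this bounds the number of points in balls. *)
Lemma eventually_tame : exists s K, [/\ 0 < s, FF [set i | tame v O s K (L i)] &
  forall S, submodule O S -> discrete v S ->
    (forall rho, #|` ball_points v S rho| <= K rho)%N -> rank_le O S r].
Proof.
have [i0 Fi0] := cauchy_L ltr01.
have [s0 [K0 [s00 t0]]] := discrete_tame (mL i0) (dL i0).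
pose B := Num.max 1 (exp_bound s0 K0 1).
have B1 : 1 <= B by rewrite le_max lexx.
have sB : 0 < B^-1 by rewrite invr_gt0 (lt_le_trans _ B1).
have [K [K1 K2]] := count_bound dO r sB.
exists B^-1, K; split => //; apply: filterS Fi0 => i Fi.
have [s [K' [s_gt0 ti]]] := discrete_tame (mL i) (dL i).
have minB : forall l, L i l -> l != 0 -> B^-1 <= v l.
  apply: (min_abs_of_exp_bound complete_C s_gt0 sphere_point ti B1) => z z1.
  rewrite -[lattice_exp v (L i) z : C](subKr (E (L i0) z)).
  apply: absB_le; first exact: (exp_le complete_C s00 t0 z1).
  by rewrite (le_trans (Fi z z1)).
by split => // rho; apply: K1.
Qed.

Section Limit.
Variables (s : R) (K : R -> nat).
Hypotheses (s0 : 0 < s) (FT : FF [set i | tame v O s K (L i)]).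

Lemma eventually_close rho e : 0 < e -> exists2 U : set I, FF U &
  (forall i, U i -> tame v O s K (L i)) /\
  (forall i j, U i -> U j -> forall z, v z <= rho -> v (E (L i) z - E (L j) z) <= e).
Proof.
move=> e0; pose rho1 := Num.max 1 rho; have r1 : 1 <= rho1 by rewrite le_max lexx.
have r0 : 0 < rho1 by exact: lt_le_trans r1.
(* Coefficients from the [J]th on contribute at most [e]. *)
have [J JP] : exists J, exp_bound s K (2 * rho1) / 2 ^+ J <= e.
  have [J] := expr_unbounded (exp_bound s K (2 * rho1) / e) (ltr1n R 2).
  rewrite ltr_pdivrMr// => /ltW h; exists J.
  by rewrite ler_pdivrMr ?exprn_gt0// [leRHS]mulrC.
have eJ : 0 < e / rho1 ^+ J by rewrite divr_gt0 ?exprn_gt0.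
have [i0 Fi0] := cauchy_L eJ.
exists ([set i | tame v O s K (L i)] `&`
  [set i | forall z, v z <= 1 -> v (E (L i0) z - E (L i) z) <= e / rho1 ^+ J]).
  exact: filterI.
split => [i []//|i j [ti ci] [tj cj] z zr].
have zr1 : v z <= rho1 by rewrite le_max zr orbT.
have cij w : v w <= 1 -> v (E (L i) w - E (L j) w) <= e / rho1 ^+ J.
  move=> w1; apply: (abs_dist_le (y := E (L i0) w)); last exact: cj.
  by rewrite abs_distC; exact: ci.
have := exp_close_propagates complete_C s0 sphere_point J ti tj eJ r1 cij zr1.
by move/le_trans; apply; rewrite ge_max JP andbT mulfVK// gt_eqF ?exprn_gt0.
Qed.

Definition near_lattice (e : R) (z : C) (i : I) : Prop := exists2 m, L i m & v (z - m) <= e.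

(** A point of one lattice is almost a zero of the exponential of the other, hence
    close to a point of the other. *)
Lemma eventually_near rho e : 0 < e -> exists2 U : set I, FF U &
  (forall i, U i -> tame v O s K (L i)) /\
  (forall i j, U i -> U j -> forall l, L i l -> v l <= rho -> near_lattice e l j).
Proof.
move=> e0; have [U FU [tU cU]] := eventually_close rho e0.
exists U => //; split => // i j Ui Uj l Ll lr.
apply: (exp_ge_dist complete_C s0 (tU j Uj) e0).
rewrite -[lattice_exp v (L j) l : C](subKr (E (L i) l)).
apply: absB_le; last exact: cU.
exact: (exp_zero complete_C s0 (tU i Ui) Ll e0).
Qed.

(** The lower limit of the lattices along the filter. *)
Definition limit_lattice : set C :=
  [set z | forall e, 0 < e -> FF (near_lattice e z)].

Local Notation Lam := limit_lattice.

Lemma limit_submodule : submodule O Lam.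
Proof.
split.
- move=> e e0; apply: filterS FT => i ti; exists 0; first exact: sm0 (mL i).
  by rewrite subrr abs0 ltW.
- move=> x y Lx Ly e e0; apply: filterS2 (Lx e e0) (Ly e e0) => i [m Lm xm] [n Ln yn].
  exists (m - n); first exact: smB (mL i) _ _ Lm Ln.
  by rewrite (_ : _ - _ = (x - m) - (y - n)); [exact: absB_le|ring].
- move=> a x Oa Lx e e0; have a0 : 0 < v a + 1 by rewrite ltr_wpDl ?abs_ge0.
  apply: filterS (Lx _ (divr_gt0 e0 a0)) => i [m Lm xm].
  exists (a * m); first exact: smZ (mL i) _ _ Oa Lm.
  rewrite -mulrBr absM; apply: (@le_trans _ _ (v a * (e / (v a + 1)))).
    by rewrite ler_wpM2l// abs_ge0.
  rewrite mulrCA; apply: ler_piMr; first exact: ltW.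
  by rewrite ler_pdivrMr// mul1r lerDl.
Qed.

(** A nonzero point has absolute value at least [s], which dominates a difference
    smaller than [s]. *)
Lemma near_abs e z i m : tame v O s K (L i) -> e < s -> (z != 0 -> s <= v z) ->
  L i m -> v (z - m) <= e -> v m = v z.
Proof.
move=> ti es zs Lm zm; have [z0|z0] := eqVneq z 0.
  rewrite z0 abs0 sub0r absN in zm *; have [->|m0] := eqVneq m 0; first by rewrite abs0.
  by have := tame_min ti Lm m0; rewrite leNgt (le_lt_trans zm).
by rewrite -(subKr z m) absB_lt// (le_lt_trans zm)// (lt_le_trans es)// zs.
Qed.

Lemma limit_min z : Lam z -> z != 0 -> s <= v z.
Proof.
move=> Lz z0; have vz : 0 < v z / 2 by rewrite divr_gt0// abs_gt0.
have [i [ti [m Lm zm]]] := filter_ex (filterI FT (Lz _ vz)).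
have vm : v m = v z.
  rewrite -(subKr z m) absB_lt// (le_lt_trans zm)//.
  by rewrite ltr_pdivrMr// ltr_pMr ?abs_gt0// ltr1n.
by rewrite -vm; apply: tame_min ti _ Lm _; rewrite -(abs_eq0 v) vm abs_eq0.
Qed.

Lemma eventually_near_seq e (q : seq C) : 0 < e -> (forall z, z \in q -> Lam z) ->
  FF [set i | forall z, z \in q -> near_lattice e z i].
Proof.
move=> e0; elim: q => [|z q IH] qL; first by apply: filterS FT.
have /IH Fq : forall y, y \in q -> Lam y by move=> y yq; apply: qL; rewrite inE yq orbT.
apply: filterS2 Fq (qL z (mem_head _ _) e e0) => i iq iz y.
by rewrite inE => /predU1P[->//|/iq].
Qed.

Lemma limit_card rho (q : seq C) : uniq q ->
  (forall z, z \in q -> Lam z /\ v z <= rho) -> (size q <= K rho)%N.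
Proof.
move=> uq qP; pose e := s / 2.
have e0 : 0 < e by rewrite divr_gt0.
have es : e < s by rewrite ltr_pdivrMr// ltr_pMr// ltr1n.
have /(eventually_near_seq e0) Fq : forall z, z \in q -> Lam z by move=> z /qP[].
have [i [ti qi]] := filter_ex (filterI FT Fq).
pose m z := if pselect (near_lattice e z i) is left h then s2val (cid2 h) else 0.
have mP z : z \in q -> L i (m z) /\ v (z - m z) <= e.
  by move=> /qi zi; rewrite /m; case: pselect => // h; case: (cid2 h).
apply: leq_trans (tame_card ti rho); rewrite -(size_map m).
apply: card_ball_points_ge; first exact: tame_discrete ti.
  rewrite map_inj_in_uniq// => x y xq yq mxy; apply/eqP; rewrite -subr_eq0.
  have [Lx _] := qP x xq; have [Ly _] := qP y yq.
  apply: contraT => xy; have := limit_min (smB limit_submodule Lx Ly) xy.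
  rewrite leNgt (le_lt_trans _ es)//; apply: (abs_dist_le (y := m x)).
    by have [] := mP x xq.
  by rewrite mxy abs_distC; have [] := mP y yq.
move=> _ /mapP[z zq ->]; have [Lm zm] := mP z zq; split => //.
have [Lz zr] := qP z zq.
by rewrite (near_abs ti es _ Lm zm)//; exact: limit_min.
Qed.

Lemma limit_tame : tame v O s K Lam.
Proof.
have dLam : discrete v Lam.
  move=> rho; apply: contrapT => inf.
  have [B Bsub] := infinite_set_fset (K rho).+1 inf.
  rewrite ltnNge => /negP; apply; apply: limit_card; first exact: fset_uniq.
  by move=> z /Bsub.
split => //; [exact: limit_submodule|exact: limit_min|].
move=> rho; apply: limit_card; first exact: fset_uniq.
by move=> z /(ball_pointsP _ _ dLam).
Qed.

(** Conversely, a lattice point far along the filter determines nearby points in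
    all later lattices; they form a Cauchy filter, and converge to a point of the
    limit lattice. *)
Lemma eventually_near_limit rho e : 0 < e -> e < s -> exists2 U : set I, FF U &
  forall i, U i -> tame v O s K (L i) /\
    forall l, L i l -> v l <= rho -> exists2 z, Lam z & v (l - z) <= e.
Proof.
move=> e0 es; have [U FU [tU nU]] := eventually_near rho e0.
exists U => // i Ui; split; [exact: tU|move=> l Ll lr].
pose f (j : I) : vtop v :=
  if pselect (near_lattice e l j) is left h then s2val (cid2 h) else 0.
have fP j : U j -> L j (f j) /\ v (l - f j) <= e.
  move=> Uj; have := nU i j Ui Uj l Ll lr; rewrite /f; case: pselect => // h _.
  by case: (cid2 h).
pose rho' := Num.max rho e.
have fr j : U j -> v (f j : C) <= rho'.
  move=> /fP[_ lf]; rewrite -(subKr l (f j : C)).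
  by apply: absB_le; rewrite le_max ?lr ?lf ?orbT.
have cf := @complete_limit R C v (f @ FF) complete_C _.
have {}cf d : 0 < d -> FF [set j | v ((lim (f @ FF) : C) - (f j : C)) < d].
  apply: cf => {}d d0; pose d' := Num.min (d / 2) e.
  have d'0 : 0 < d' by rewrite lt_min e0 divr_gt0.
  have d'd : d' < d by rewrite gt_min ltr_pdivrMr// ltr_pMr// ltr1n.
  have [V FV [tV nV]] := eventually_near rho' d'0.
  have [j0 [Vj0 Uj0]] := filter_ex (filterI FV FU).
  exists (f j0); rewrite -[_ _]/(FF [set j | v ((f j0 : C) - (f j : C)) < d]).
  apply: filterS2 FV FU => j Vj Uj; rewrite /mkset.
  have [Lj0 lj0] := fP j0 Uj0; have [Lj lj] := fP j Uj.
  have [m Lm jm] := nV j0 j Vj0 Vj _ Lj0 (fr j0 Uj0).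
  suff -> : (f j : C) = m by exact: le_lt_trans jm d'd.
  apply/eqP; rewrite -subr_eq0; apply: contraT => jm0.
  have := tame_min (tV j Vj) (smB (mL j) Lj Lm) jm0; rewrite leNgt (le_lt_trans _ es)//.
  apply: (abs_dist_le (y := l)); first by rewrite abs_distC.
  apply: (abs_dist_le lj0); apply: (le_trans jm).
  by rewrite ge_min lexx orbT.
exists (lim (f @ FF)).
  move=> d d0; apply: filterS2 FU (cf d d0) => j Uj fj.
  by exists (f j); [have [] := fP j Uj|exact: ltW].
have [j [Uj fj]] := filter_ex (filterI FU (cf e e0)).
apply: (abs_dist_le (y := (f j : C))); first by have [] := fP j Uj.
by rewrite abs_distC ltW.
Qed.

(** Moving points by less than [s] is a bijection between the nonzero points of
    absolute value at most [N] of the limit and of a lattice far along the filter. *)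
Lemma limit_partial_exp (N : R) z e : 0 < e -> v z <= 1 ->
  FF [set i | v (partial_exp v Lam N z - partial_exp v (L i) N z) <= e].
Proof.
move=> e0 z1; have tLam := limit_tame; have dLam := tame_discrete tLam.
pose B := Num.max 1 s^-1; have B1 : 1 <= B by rewrite le_max lexx.
have B0 : 0 < B by exact: lt_le_trans B1.
set Z := nonzero_points v Lam N.
pose d := Num.min (s / 2) (e * s ^+ 2 / B ^+ size Z).
have d0 : 0 < d by rewrite lt_min !divr_gt0 ?mulr_gt0 ?exprn_gt0.
have ds : d < s by rewrite gt_min ltr_pdivrMr// ltr_pMr// ltr1n.
have de : d / s ^+ 2 * B ^+ size Z <= e.
  rewrite mulrAC ler_pdivrMr ?exprn_gt0// -ler_pdivlMr ?exprn_gt0//.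
  by rewrite ge_min lexx orbT.
have [U FU UP] := eventually_near_limit N d0 ds.
have FZ : FF [set i | forall l, l \in Z -> near_lattice d l i].
  by apply: eventually_near_seq => // l /(nonzero_pointsP _ _ dLam)[].
apply: filterS2 FU FZ => i /UP[ti nearLam] nearL; rewrite /mkset.
pose m l := if pselect (near_lattice d l i) is left h then s2val (cid2 h) else 0.
have mP l : l \in Z -> L i (m l) /\ v (l - m l) <= d.
  by move=> /nearL li; rewrite /m; case: pselect => // h; case: (cid2 h).
have vm l : l \in Z -> v (m l) = v l.
  move=> lZ; have [Lm lm] := mP l lZ; apply: (near_abs ti ds _ Lm lm).
  by move: lZ => /(nonzero_pointsP _ _ dLam)[Ll _ _]; exact: limit_min.
have dLi := tame_discrete ti.
have perm : perm_eq (nonzero_points v (L i) N) [seq m l | l <- Z].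
  apply: uniq_perm; first exact: fset_uniq.
    rewrite map_inj_in_uniq ?fset_uniq// => x y xZ yZ mxy.
    have [_ xm] := mP x xZ; have [_ ym] := mP y yZ.
    move: xZ yZ => /(nonzero_pointsP _ _ dLam)[Lx _ _] /(nonzero_pointsP _ _ dLam)[Ly _ _].
    apply/eqP; rewrite -subr_eq0; apply: contraT => xy0.
    have := limit_min (smB limit_submodule Lx Ly) xy0; rewrite leNgt (le_lt_trans _ ds)//.
    by apply: (abs_dist_le xm); rewrite mxy abs_distC.
  move=> k; apply/(nonzero_pointsP _ _ dLi)/mapP => [[Lk k0 kN]|[l lZ ->]].
    have [l Ll kl] := nearLam k Lk kN.
    have vl : v l = v k.
      rewrite -(subKr k l) absB_lt// (le_lt_trans kl)// (lt_le_trans ds)//.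
      exact: tame_min ti _ Lk k0.
    have lZ : l \in Z.
      apply/(nonzero_pointsP _ _ dLam); split; rewrite ?vl//.
      by rewrite -(abs_eq0 v) vl abs_eq0.
    exists l => //; have [Lm lm] := mP l lZ.
    apply/eqP; rewrite -subr_eq0; apply: contraT => km0.
    have := tame_min ti (smB (mL i) Lk Lm) km0; rewrite leNgt (le_lt_trans _ ds)//.
    exact: (abs_dist_le kl).
  have [Lm lm] := mP l lZ; have ml := vm l lZ.
  move: lZ => /(nonzero_pointsP _ _ dLam)[_ l0 lN].
  by split => //; rewrite ?ml// -(abs_eq0 v) ml abs_eq0.
rewrite /partial_exp (perm_big _ perm) big_map -mulrBr absM -[e]mul1r.
apply: ler_pM; rewrite ?abs_ge0//; apply: le_trans de.
apply: prod_close => //; first by rewrite divr_ge0 ?exprn_ge0// ltW.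
have zl l : s <= v l -> v (1 - z / l) <= B.
  move=> sl; have vl : 0 < v l by exact: lt_le_trans sl.
  apply: absB_le; first by rewrite abs1.
  rewrite absM absV le_max; apply/orP; right.
  by rewrite -[leRHS]mul1r ler_pM ?abs_ge0 ?invr_ge0 ?abs_ge0// lef_pV2.
move=> l lZ; have [Lm lm] := mP l lZ; have ml := vm l lZ.
have sl : s <= v l.
  by move: lZ => /(nonzero_pointsP _ _ dLam)[Ll l0 _]; exact: limit_min.
split; [exact: zl|by apply: zl; rewrite ml|].
have l0 : l != 0 by rewrite -(abs_gt0 v) (lt_le_trans s0).
have m0 : m l != 0 by rewrite -(abs_gt0 v) ml (lt_le_trans s0).
have -> : 1 - z / l - (1 - z / m l) = z * (l - m l) / (l * m l) by field; rewrite ?l0 ?m0.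
rewrite absM absV !absM ml -expr2; apply: ler_pM.
- by rewrite mulr_ge0 ?abs_ge0.
- by rewrite invr_ge0 exprn_ge0 ?abs_ge0.
- by rewrite -[d]mul1r ler_pM ?abs_ge0.
- by rewrite lef_pV2 ?posrE ?exprn_gt0 ?(lt_le_trans s0)// lerXn2r ?nnegrE ?abs_ge0// ltW.
Qed.

Lemma limit_exp e : 0 < e ->
  FF [set i | forall z, v z <= 1 -> v (E Lam z - E (L i) z) <= e].
Proof.
move=> e0; have [U FU [tU cU]] := eventually_close 1 e0.
apply: (filterS _ FU) => i Ui z z1.
have [N /(_ N (leqnn _))[_ NP]] := exp_approx_uniform O complete_C K s0 ltr01 e0.
have [j [Uj pj]] := filter_ex (filterI FU (limit_partial_exp N%:R e0 z1)).
apply: (abs_dist_le (y := E (L j) z)); last exact: cU.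
apply: (abs_dist_le (NP _ _ limit_tame z1)).
apply: (abs_dist_le pj); rewrite abs_distC.
exact: NP (tU j Uj) z1.
Qed.

End Limit.

Lemma cauchy_lattices_converge : exists S, [/\ submodule O S, discrete v S, rank_le O S r &
  forall e, 0 < e -> FF [set i | forall z, v z <= 1 -> v (E S z - E (L i) z) <= e]].
Proof.
have [s [K [s0 FT KP]]] := eventually_tame.
have tS := limit_tame s0 FT; exists limit_lattice.
split; [exact: tame_mod tS|exact: tame_discrete tS| |].
  by apply: KP (tame_mod tS) (tame_discrete tS) _; exact: tame_card tS.
by move=> e; exact: limit_exp s0 FT e.
Qed.

End CauchyLattices.

(** * Adjoining large elements to a lattice *)

Section Adjoin.
Variables (R : realType) (C : fieldType) (v : absval R C) (O : set C).
Hypothesis dO : discrete_ring v O.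

Let mO : submodule O O := ring_submodule dO.
Let O0 : O 0 := sm0 mO.

Lemma free_lift n (b : 'I_n.+1 -> C) : O_free O b -> O_free O (fun k => b (lift ord0 k)).
Proof.
move=> fb a Oa sum0 k; pose a' := fcons 0 a.
have a'E l : a' (lift ord0 l) = a l by rewrite /a' /fcons liftK.
rewrite -a'E; apply: fb; first exact: fconsP.
rewrite big_ord_recl {1}/a' /fcons unlift_none mul0r add0r -[RHS]sum0.
by apply: eq_bigr => l _; rewrite -/(fcons 0 a) -/a' a'E.
Qed.

Lemma rank_leW L m n : (m <= n)%N -> rank_le O L m -> rank_le O L n.
Proof.
move=> /subnK <-; elim: (n - m)%N => // k IH rL; rewrite addSn => b Lb /free_lift.
exact: (IH rL (fun k => b (lift ord0 k))).
Qed.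

Definition adjoin (L : set C) (w : C) : set C :=
  [set z | exists2 a, O a & exists2 l, L l & z = a * w + l].

Variables (L : set C) (w : C).
Hypotheses (mL : submodule O L) (dL : discrete v L) (w0 : w != 0).
Hypothesis transverse : forall a l, O a -> L l -> v (a * w) <= v (a * w + l).

Lemma sub_adjoin : L `<=` adjoin L w.
Proof. by move=> l Ll; exists 0 => //; exists l => //; rewrite mul0r add0r. Qed.

Lemma adjoin_submodule : submodule O (adjoin L w).
Proof.
split.
- exact/sub_adjoin/(sm0 mL).
- move=> _ _ [a Oa [l Ll ->]] [b Ob [m Lm ->]]; exists (a - b); first exact: smB mO _ _ Oa Ob.
  by exists (l - m); [exact: smB mL _ _ Ll Lm|ring].
- move=> c _ Oc [a Oa [l Ll ->]]; exists (c * a); first exact: smZ mO _ _ Oc Oa.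
  by exists (c * l); [exact: smZ mL _ _ Oc Ll|ring].
Qed.

Lemma adjoin_far z : adjoin L w z -> ~ L z -> v w <= v z.
Proof.
move=> [a Oa [l Ll ->]]; have [->|a0] := eqVneq a 0; first by rewrite mul0r add0r.
move=> _; apply: le_trans (transverse Oa Ll).
by rewrite absM ler_peMl ?abs_ge0//; exact: dr_ge1 dO _ Oa a0.
Qed.

Lemma adjoin_discrete : discrete v (adjoin L w).
Proof.
move=> rho; have vw : 0 < v w by rewrite abs_gt0.
pose D := (O `&` [set a | v a <= rho / v w]) `*` (L `&` [set l | v l <= rho]).
have fD : finite_set D by apply: finite_setX; [exact: ring_discrete dO _|exact: dL].
apply: (@sub_finite_set _ _ ((fun p => p.1 * w + p.2) @` D)); last exact: finite_image.
move=> _ [[a Oa [l Ll ->]] zr]; exists (a, l) => //.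
have awr : v (a * w) <= rho := le_trans (transverse Oa Ll) zr.
split; split => //=; first by rewrite ler_pdivlMr// -absM.
by rewrite (_ : l = a * w + l - a * w); [exact: absB_le|ring].
Qed.

Lemma adjoin_free n (b : 'I_n -> C) : (forall k, L (b k)) -> O_free O b ->
  O_free O (fcons w b).
Proof.
move=> Lb fb a Oa; rewrite fcons_sum => sum0.
have Ls : L (\sum_k a (lift ord0 k) * b k).
  by apply: sm_sum mL _ => k; exact: smZ mL _ _ (Oa _) (Lb _).
have a0 : a ord0 = 0.
  have := transverse (Oa ord0) Ls; rewrite sum0 abs0 absM => h.
  apply/eqP; rewrite -(abs_eq0 v) eq_le abs_ge0 andbT.
  by rewrite -(pmulr_lle0 _ (_ : 0 < v w)) ?abs_gt0.
rewrite a0 mul0r add0r in sum0 => k.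
by have [l ->|->//] := unliftP ord0 k; exact: (fb (fun l => a (lift ord0 l))).
Qed.

(** One element of a free family with a nonzero component along [w] eliminates that
    component from all the others. *)
Lemma adjoin_rank_le n : rank_le O L n -> rank_le O (adjoin L w) n.+1.
Proof.
move=> rL b Lb fb.
have /(_ _)/cid-/all_sig[a aP] k : exists a, O a /\ exists2 l, L l & b k = a * w + l.
  by have [a Oa al] := Lb k; exists a.
have [[j aj]|a0] := pselect (exists j, a j != 0); last first.
  apply: (rL (fun k => b (lift ord0 k))); last exact: free_lift.
  move=> k; have [_ [l Ll ->]] := aP (lift ord0 k).
  have [->|ak] := eqVneq (a (lift ord0 k)) 0; first by rewrite mul0r add0r.
  by case: a0; exists (lift ord0 k).
apply: (rL (fun k => a j * b (lift j k) - a (lift j k) * b j)).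
  move=> k; have [Oj [l Ll ->]] := aP j; have [Ok [m Lm ->]] := aP (lift j k).
  rewrite (_ : _ - _ = a j * m - a (lift j k) * l); last by ring.
  exact: smB mL _ _ (smZ mL Oj Lm) (smZ mL Ok Ll).
move=> c Oc sum0 k.
pose c' l := if unlift j l is Some m then a j * c m else - \sum_m c m * a (lift j m).
have c'0 : forall l, c' l = 0.
  apply: fb => [l|].
    rewrite /c'; case: unliftP => [m|] _; first by apply: smZ mO _ _ _ (Oc m); have [] := aP j.
    rewrite -sub0r; apply: smB mO _ _ O0 _; apply: sm_sum mO _ => m.
    by apply: smZ mO _ _ (Oc m) _; have [] := aP (lift j m).
  rewrite (bigD1_ord j)//= {1}/c' unlift_none mulNr mulr_suml -sumrN -big_split/= -[RHS]sum0.
  by apply: eq_bigr => m _; rewrite /c' liftK; ring.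
have := c'0 (lift j k); rewrite /c' liftK => /eqP.
by rewrite mulf_eq0 (negbTE aj) => /eqP.
Qed.

Lemma adjoin_span n (g : 'I_n -> C) : L = O_span O g -> adjoin L w = O_span O (fcons w g).
Proof.
move=> ->; apply/seteqP; split => z.
  move=> [a Oa [_ [b Ob ->] ->]]; exists (fcons a b); first exact: fconsP.
  rewrite fcons_sum /fcons unlift_none; congr (_ + _).
  by apply: eq_bigr => k _; rewrite liftK.
move=> [a Oa ->]; rewrite fcons_sum; exists (a ord0) => //.
by eexists; last reflexivity; exists (fun k => a (lift ord0 k)).
Qed.

End Adjoin.

Section Ramified.
Variables (R : realType) (C : fieldType) (v : absval R C).

Lemma abs_sum_lt (I : finType) (p : pred I) (t : I -> C) c : 0 < c ->
  (forall k, p k -> v (t k) < c) -> v (\sum_(k | p k) t k) < c.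
Proof.
move=> c0 tc; elim/big_ind: _ => //; first by rewrite abs0.
by move=> x y xc yc; rewrite (le_lt_trans (absD _ _ _))// gt_max xc.
Qed.

Lemma sum_distinct_abs (I : finType) (t : I -> C) :
  (forall k l, t k != 0 -> t l != 0 -> v (t k) = v (t l) -> k = l) ->
  \sum_k t k = 0 -> forall k, t k = 0.
Proof.
move=> inj sum0 k; apply/eqP; apply: contraT => k0.
have [m _ mP] := @arg_maxP _ _ _ k xpredT (fun l => v (t l)) isT.
have m0 : 0 < v (t m) by rewrite (lt_le_trans _ (mP k isT))// abs_gt0.
move/eqP: sum0; rewrite (bigD1 m)//= -(abs_eq0 v) absD_lt ?gt_eqF//.
apply: abs_sum_lt => // l lm; have : v (t l) <= v (t m) := mP l isT; rewrite le_eqVlt => /predU1P[E|//].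
have l0 : t l != 0 by rewrite -(abs_gt0 v) E.
by case/eqP: lm; apply: inj => //; rewrite -(abs_gt0 v).
Qed.

Variables (Fq : finFieldType) (F : fieldExtType {fraction {poly Fq}}).
Variables (P : place F) (d : nat) (Pd : place_degree P d) (i : {rmorphism F -> C}).
Hypothesis vi : forall x, v (i x) = place_abs R P #|Fq| d x.
Hypothesis roots : forall (x : F) n, exists u, u ^+ n.+1 = i x.

(** With [u ^+ n.+1] a uniformiser, the [u ^+ j] for [j <= n] have absolute values
    in distinct classes modulo the value group of [F].  A subspace of dimension
    at most [n] over [F] meets at most [n] of these classes. *)
Lemma transverse_direction n (g : 'I_n -> C) : exists2 u : C, u != 0 &
  forall (f : F) (c : 'I_n -> F), f != 0 -> v (\sum_k i (c k) * g k) != v (i f * u).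
Proof.
have [t t0 Pt] := ord_surj P; have [u uE] := roots t n.
have un0 : u ^+ n.+1 != 0 by rewrite uE fmorph_eq0.
have u0 : u != 0 by move: un0; rewrite expf_eq0.
have distinct (f f' : F) (j j' : 'I_n.+1) : f != 0 -> f' != 0 ->
    v (i f * u ^+ j) = v (i f' * u ^+ j') -> j = j'.
  move=> f0 f'0 /(congr1 (fun x => x ^+ n.+1)); rewrite -!absX !exprMn.
  rewrite -!exprM !(mulnC _ n.+1) !exprM uE -!rmorphXn -!rmorphM.
  rewrite !(abs_place vi) ?mulf_neq0 ?expf_neq0// => /eqP.
  rewrite !ordM ?expf_neq0// !ordX// Pt => /eqP.
  have q1 : 1 < #|Fq|%:R :> R by rewrite ltr1n finNzRing_gt1.
  have q0 : 0 < #|Fq|%:R :> R := lt_trans ltr01 q1.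
  move=> /(ieexprIz q0 (negbT (gt_eqF q1)))/oppr_inj E.
  have dZ : d%:Z != 0 by rewrite eqz_nat -lt0n (place_degree_gt0 Pd).
  have {E} := mulfI dZ E; rewrite -(mulr_natr (P f)) -(mulr_natr (P f')) !natz => E; apply: val_inj => /=.
  have := congr1 (modz^~ n.+1%:Z) E; rewrite !modzMDl !modz_small; first by case.
    by rewrite lez_nat ltz_nat ltn_ord.
  by rewrite lez_nat ltz_nat ltn_ord.
apply: contrapT => nu.
have /(_ _)/cid-/all_sig[f fP] (j : 'I_n.+1) : exists f : F, exists c : 'I_n -> F,
    f != 0 /\ v (\sum_k i (c k) * g k) = v (i f * u ^+ j).
  apply: contrapT => nf; apply: nu; exists (u ^+ j); first by rewrite expf_neq0.
  by move=> f c f0; apply/eqP => E; apply: nf; exists f, c.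
have {fP}/(_ _)/cid-/all_sig[c cP] := fP.
pose A : 'M[F]_(n.+1, n) := \matrix_(j, k) c j k.
have /rowV0Pn[a aK a0] : kermx A != 0.
  by rewrite kermx_eq0 /row_free neq_ltn ltnS rank_leq_col.
have aA : a *m A = 0 by apply/sub_kermxP.
have sum0 : \sum_j i (a ord0 j) * (\sum_k i (c j k) * g k) = 0.
  under eq_bigr do rewrite mulr_sumr; rewrite exchange_big/= big1// => k _.
  have /rowP/(_ k) := aA; rewrite !mxE => E.
  transitivity (i 0 * g k); last by rewrite rmorph0 mul0r.
  rewrite -E rmorph_sum/= mulr_suml.
  by apply: eq_bigr => j _; rewrite mxE rmorphM mulrA.
case/eqP: a0; apply/rowP => j; rewrite mxE; apply: contrapT => /eqP aj.
have vt l : v (i (a ord0 l) * (\sum_k i (c l k) * g k)) = v (i (a ord0 l * f l) * u ^+ l).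
  by rewrite absM; have [_ ->] := cP l; rewrite rmorphM -mulrA [RHS]absM.
have := sum_distinct_abs _ sum0 j => /(_ _)/eqP; rewrite -(abs_eq0 v) vt abs_eq0.
have [fj _] := cP j.
rewrite !mulf_eq0 fmorph_eq0 mulf_eq0 (negbTE aj) (negbTE fj) expf_eq0 (negbTE u0) andbF.
move=> h; suff : false by [].
apply: h => k l; rewrite -!(abs_eq0 v) !vt !abs_eq0 !mulf_eq0 !fmorph_eq0 !mulf_eq0 !negb_or.
move=> /andP[/andP[ak fk] _] /andP[/andP[al fl] _].
by apply: distinct; rewrite mulf_neq0.
Qed.

End Ramified.

(** * The completion of the space of lattices *)

Section Lattices.
Variables (R : realType) (F C : fieldType) (P : place F).
Variables (v : absval R C) (i : {rmorphism F -> C}).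
Local Notation O := (i @` regular_away P).

Lemma A_span_image n (g : 'I_n -> C) : A_span P i g = O_span O g.
Proof.
apply/seteqP; split => z [a Aa ->].
  by exists (fun k => i (a k)) => // k; exists (a k).
have /(_ _)/cid2-/all_sig2[b Ab bE] := Aa.
by exists b => //; apply: eq_bigr => k _; rewrite bE.
Qed.

Lemma A_free_image n (b : 'I_n -> C) : A_free P i b <-> O_free O b.
Proof.
split=> fb a Aa.
  have /(_ _)/cid2-/all_sig2[c Ac cE] := Aa => sum0 k.
  rewrite -cE (fb c) ?rmorph0// -[RHS]sum0.
  by apply: eq_bigr => l _; rewrite cE.
move=> sum0 k; apply: (fmorph_inj i); rewrite rmorph0.
by apply: (fb (fun l => i (a l))) => // l; exists (a l).
Qed.

Hypothesis dO : discrete_ring v O.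

Lemma is_latticeP L : is_lattice P v i L <->
  [/\ exists n (g : 'I_n -> C), L = O_span O g, submodule O L & discrete v L].
Proof.
split=> [[[n [g ->]] dL]|[[n [g LE]] mL dL]].
  rewrite A_span_image in dL *; split => //; [by exists n, g|exact: span_submodule dO _ _].
by split => //; exists n, g; rewrite A_span_image.
Qed.

Lemma has_rankP L n : has_rank P i L n <->
  (exists2 b : 'I_n -> C, (forall k, L (b k)) & O_free O b) /\ rank_le O L n.
Proof.
split=> -[[b Lb fb] rL]; split.
- by exists b => //; apply/A_free_image.
- by move=> c Lc /A_free_image; exact: rL.
- by exists b => //; apply/A_free_image.
- by move=> c Lc /A_free_image; exact: rL.
Qed.

End Lattices.

Section SuperLattices.
Variables (R : realType) (Fq : finFieldType) (F : fieldExtType {fraction {poly Fq}}).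
Variables (P : place F) (d : nat) (Pd : place_degree P d).
Variables (C : fieldType) (v : absval R C) (i : {rmorphism F -> C}).
Hypothesis vi : forall x, v (i x) = place_abs R P #|Fq| d x.
Hypothesis roots : forall (x : F) n, exists u, u ^+ n.+1 = i x.
Local Notation O := (i @` regular_away P).
Let dO : discrete_ring v O := place_discrete_ring Pd vi.

(** A direction transverse to the [F]-span of [L] stays transverse when multiplied
    by an element of [F], so it can be taken large. *)
Lemma superlattice_step L n M : is_lattice P v i L -> has_rank P i L n ->
  exists S, [/\ is_lattice P v i S, has_rank P i S n.+1, L `<=` S &
    forall z, S z -> ~ L z -> M <= v z].
Proof.
move=> /(is_latticeP dO)[[m [g LE]] mL dL] /has_rankP[[b Lb fb] rL].
have [u u0 uP] := transverse_direction Pd vi roots g.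
have [y y0 yM] : exists2 y : F, y != 0 & M <= v (i y * u).
  pose e := v u / (`|M| + 1); have M1 : 0 < `|M| + 1 by rewrite ltr_wpDl.
  have e0 : 0 < e by rewrite divr_gt0// abs_gt0.
  have [x x0 xe] := abs_place_small Pd vi e0.
  exists x^-1; first by rewrite invr_eq0.
  have vx : 0 < v (i x) by rewrite abs_gt0 fmorph_eq0.
  rewrite absM fmorphV absV mulrC ler_pdivlMr//.
  apply: (@le_trans _ _ ((`|M| + 1) * v (i x))).
    by rewrite ler_wpM2r ?abs_ge0// (le_trans (ler_norm M))// lerDl.
  by rewrite mulrC -ler_pdivlMr// ltW.
pose w := i y * u; have w0 : w != 0 by rewrite mulf_neq0 ?fmorph_eq0.
have transverse a l : O a -> L l -> v (a * w) <= v (a * w + l).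
  move=> [c Ac <-]; rewrite LE => -[f Of ->].
  have /(_ _)/cid2-/all_sig2[h Ah hE] := Of.
  have [->|c0] := eqVneq c 0; first by rewrite rmorph0 mul0r abs0 abs_ge0.
  have fg : \sum_k f k * g k = \sum_k i (h k) * g k.
    by apply: eq_bigr => k _; rewrite hE.
  have cw : i c * w = i (c * y) * u by rewrite /w mulrA rmorphM.
  have := uP (c * y) h (mulf_neq0 c0 y0); rewrite fg cw.
  rewrite neq_lt => /orP[lt|lt]; first by rewrite absD_lt.
  by rewrite addrC absD_lt// ltW.
exists (adjoin O L w); split.
- apply/(is_latticeP dO); split.
  + by exists m.+1, (fcons w g); exact: adjoin_span LE.
  + exact: (adjoin_submodule dO w mL).
  + exact: (adjoin_discrete dO dL w0 transverse).
- apply/has_rankP; split; last exact: (adjoin_rank_le dO mL rL).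
  exists (fcons w b); last exact: (adjoin_free mL w0 transverse Lb fb).
  apply: fconsP; last by move=> k; exact: (sub_adjoin dO w (Lb k)).
  by exists 1; [exact: dr1 dO|exists 0; [exact: sm0 mL|rewrite mul1r addr0]].
- exact: (sub_adjoin dO w).
- by move=> z Sz Lz; apply: le_trans yM _; exact: (adjoin_far dO transverse Sz Lz).
Qed.

Lemma superlattice L n k M : is_lattice P v i L -> has_rank P i L n ->
  exists S, [/\ is_lattice P v i S, has_rank P i S (n + k), L `<=` S &
    forall z, S z -> ~ L z -> M <= v z].
Proof.
move=> lL rL; elim: k => [|k [S [lS rS LS SM]]].
  by exists L; rewrite addn0; split.
have [S' [lS' rS' SS' S'M]] := superlattice_step M lS rS.
exists S'; rewrite addnS; split => // [|z S'z Lz].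
  exact: subset_trans SS'.
by have [Sz|nSz] := pselect (S z); [exact: SM|exact: S'M].
Qed.

End SuperLattices.

Lemma lattice_dist_le (R : realType) (C : fieldType) (v : absval R C) (L1 L2 : set C) e :
  (lattice_dist v L1 L2 <= e%:E)%E <->
  (forall z, v z <= 1 -> v ((lattice_exp v L1 z : C) - lattice_exp v L2 z) <= e).
Proof.
split=> [le z z1|le]; last by apply: ge_ereal_sup => _ [z z1 <-]; rewrite lee_fin; exact: le.
by rewrite -lee_fin; apply: le_trans le; apply: ereal_sup_ubound; exists z.
Qed.

Theorem theorem11 (R : realType) (Fq : finFieldType)
    (F : fieldExtType {fraction {poly Fq}}) (Fconst : full_constants F)
    (infty : place F) (delta : nat) (Hdelta : place_degree infty delta)
    (Finf : fieldType) (vinf : absval R Finf) (i1 : {rmorphism F -> Finf})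
    (Hinf : is_completion (@place_abs R F infty #|Fq| delta) vinf i1)
    (Fbar : closedFieldType) (vbar : absval R Fbar)
    (i2 : {rmorphism Finf -> Fbar}) (Hbar : is_algebraic_closure i2)
    (Hvbar : forall x, vbar (i2 x) = vinf x)
    (Cinf : fieldType) (v : absval R Cinf) (i3 : {rmorphism Fbar -> Cinf})
    (Hc : is_completion vbar v i3)
    (r : nat) (Hr : (1 <= r)%N) :
  cauchy_complete (lattice_le infty v (i3 \o i2 \o i1) r) /\
  dense (@lattice_eq R F Cinf infty v (i3 \o i2 \o i1) r).
Proof.
have [vi1 _ _] := Hinf; have [vi3 complete_C dense_C] := Hc.
set i : {rmorphism F -> Cinf} := (i3 \o i2 \o i1)%FUN.
have vi x : v (i x) = place_abs R infty #|Fq| delta x by rewrite /= vi3 Hvbar vi1.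
have dO := place_discrete_ring Hdelta vi.
have sphere := dense_closed_sphere_point vi3 dense_C.
have roots (x : F) n : exists u, u ^+ n.+1 = i x.
  have /closed_rootP[u] : size ('X^(n.+1) - (i2 (i1 x))%:P : {poly Fbar}) != 1%N.
    by rewrite size_XnsubC.
  rewrite /root hornerD hornerN hornerC hornerXn subr_eq0 => /eqP ux.
  by exists (i3 u); rewrite -rmorphXn ux.
split.
  move=> FF PF /cauchyP cF.
  have lP (L : lattice_le infty v i r) := iffLR (is_latticeP dO _) (carrier_lattice L).
  have mL (L : lattice_le infty v i r) : submodule (i @` regular_away infty) L.
    by have [] := lP L.
  have dL (L : lattice_le infty v i r) : discrete v L by have [] := lP L.
  have rL (L : lattice_le infty v i r) : rank_le (i @` regular_away infty) L r.
    have [n nr /has_rankP[_ Ln]] := carrier_rank L; exact: (rank_leW dO nr Ln).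
  have cL (e : R) : 0 < e -> exists L0 : lattice_le infty v i r, FF [set L | forall z,
      v z <= 1 -> v ((lattice_exp v L0 z : Cinf) - lattice_exp v L z) <= e].
    move=> /cF[L0 FL0]; exists L0; apply: filterS FL0 => L L0L.
    by apply/lattice_dist_le/ltW; exact: L0L.
  have [S [mS dS rS FS]] := cauchy_lattices_converge complete_C dO sphere PF mL dL rL cL.
  have lS : is_lattice infty v i S.
    by apply/(is_latticeP dO); split => //; exact: discrete_finitely_generated dO S r mS dS rS.
  have kS : exists2 n, (n <= r)%N & has_rank infty i S n.
    have [n [b [nr Sb fb rn _]]] := maximal_free dO rS.
    by exists n => //; apply/has_rankP; split => //; exists b.
  apply/cvg_ex; exists (LatticeLe lS kS); apply/cvg_ballP => e e0.
  have e2 : 0 < e / 2 by rewrite divr_gt0.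
  apply: filterS (FS _ e2) => L SL; rewrite /ball/= /lattice_ball/=.
  apply: (@le_lt_trans _ _ (e / 2)%:E); first exact/lattice_dist_le.
  by rewrite lte_fin ltr_pdivrMr// ltr_pMr// ltr1n.
move=> U [L UL] openU; have : nbhs L U by rewrite openE in openU; exact: openU.
rewrite -nbhs_ballE => -[e /= e0 LU].
have lL := carrier_lattice L; have [n nr kL] := carrier_rank L.
have [_ mL dL] := iffLR (is_latticeP dO _) lL.
have [s [K [s0 tL]]] := discrete_tame mL dL.
(* New elements beyond [M] change the exponential by at most [e / 2]. *)
pose M := Num.max 1 (2 * exp_bound s K 1 / e).
have M1 : 1 <= M by rewrite le_max lexx.
have M0 : 0 < M by exact: lt_le_trans M1.
have [S [lS kS LS far]] := superlattice Hdelta vi roots (r - n) M lL kL.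
rewrite subnKC// in kS.
have kS' : exists2 n, (n <= r)%N & has_rank infty i S n by exists r.
exists (LatticeLe lS kS'); split => //; apply: LU.
have [_ mS dS] := iffLR (is_latticeP dO _) lS.
have [s' [K' [s'0 tS]]] := discrete_tame mS dS.
rewrite /ball/= /lattice_ball/=.
apply: (@le_lt_trans _ _ (e / 2)%:E); last first.
  by rewrite lte_fin ltr_pdivrMr// ltr_pMr// ltr1n.
apply/lattice_dist_le => z z1.
apply: le_trans (exp_superlattice_close complete_C s0 s'0 tL tS LS M1 far z1) _.
rewrite ler_pdivrMr// mulrC -ler_pdivrMr ?divr_gt0// invf_div.
by rewrite le_max; apply/orP; right; rewrite mulrCA mulrA.
Qed.
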